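(* Let $(N,\underline X)\in\aleph^{FGM*}$ with $E[N^k]<\infty$ and $E[X^k]<\infty$ for $k=1,2$. Write $R_n=\frac{\gamma_{N_{[2]}}(n)-\gamma_{N_{[1]}}(n)}{\gamma_N(n)}$ for $n\in A_N$ and $D=\mu_{X_{[2]}}-\mu_{X_{[1]}}$. Then $\mathrm{Var}(S)=E[N\,\mathrm{Var}(X_1\mid N)]+E[N(N-1)\mathrm{Cov}(X_1,X_2\mid N)]+\mathrm{Var}(N\,E[X_1\mid N])$ (with the middle term equal to $0$ if $\sup A_N\le1$), where $$E[N\mathrm{Var}(X_1\mid N)]=E[N]\mathrm{Var}(X)+\frac{\theta_{01}}{4}(\mu_{N_{[2]}}-\mu_{N_{[1]}})\big(\mathrm{Var}(X_{[2]})-\mathrm{Var}(X_{[1]})\big)-\frac{\theta_{01}^2}{16}D^2\sum_{n\ge1}\gamma_N(n)\,n\,R_n^2,$$ $$E[N(N-1)\mathrm{Cov}(X_1,X_2\mid N)]=\frac{\theta_{12}}{4}(\mu_N^{(2)}-\mu_N)D^2-\frac{\theta_{012}}{8}\big(\mu^{(2)}_{N_{[2]}}-\mu_{N_{[2]}}-\mu^{(2)}_{N_{[1]}}+\mu_{N_{[1]}}\big)D^2-\frac{\theta_{01}^2}{16}D^2\sum_{n\ge1}\gamma_N(n)n^2R_n^2+\frac{\theta_{01}^2}{16}D^2\sum_{n\ge1}\gamma_N(n)\,n\,R_n^2,$$ $$\mathrm{Var}(NE[X_1\mid N])=\mathrm{Var}(N)E[X]^2+\frac{\theta_{01}}{4}\big(\mathrm{Var}(N_{[2]})-\mathrm{Var}(N_{[1]})\big)(\mu_{X_{[2]}}^2-\mu_{X_{[1]}}^2)+\frac{\theta_{01}}{8}(\mu_{N_{[2]}}^2-\mu_{N_{[1]}}^2)(\mu_{X_{[2]}}^2-\mu_{X_{[1]}}^2)+\frac{\theta_{01}^2}{16}D^2\sum_{n\ge1}\gamma_N(n)n^2R_n^2-\frac{\theta_{01}^2}{16}(\mu_{N_{[2]}}-\mu_{N_{[1]}})^2D^2.$$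 Consequently $\mathrm{Var}(S)=E[N]\mathrm{Var}(X)+\mathrm{Var}(N)E[X]^2+C^{Var}_{Dep}(S)$ with $$C^{Var}_{Dep}(S)=\frac{\theta_{01}}{4}\Big[(\mu_{N_{[2]}}-\mu_{N_{[1]}})\big(\mathrm{Var}(X_{[2]})-\mathrm{Var}(X_{[1]})\big)+\big(\mathrm{Var}(N_{[2]})-\mathrm{Var}(N_{[1]})\big)(\mu_{X_{[2]}}^2-\mu_{X_{[1]}}^2)+\tfrac12(\mu_{N_{[2]}}^2-\mu_{N_{[1]}}^2)(\mu_{X_{[2]}}^2-\mu_{X_{[1]}}^2)\Big]$$ $$\quad-\frac{\theta_{01}^2}{16}(\mu_{N_{[2]}}-\mu_{N_{[1]}})^2D^2+\frac{\theta_{12}}{4}(\mu_N^{(2)}-\mu_N)D^2-\frac{\theta_{012}}{8}\Big[(\mu^{(2)}_{N_{[2]}}-\mu_{N_{[2]}})-(\mu^{(2)}_{N_{[1]}}-\mu_{N_{[1]}})\Big]D^2.$$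
   Context: Collective risk model (CRM): $N$ is a random variable with values in $\mathbb{N}_0$, cdf $F_N$, pmf $\gamma_N(n)=\Pr(N=n)$ and support $A_N=\{n:\gamma_N(n)>0\}$; $\underline X=\{X_j\}_{j\ge1}$ is a sequence of identically distributed strictly positive random variables with common cdf $F_X$ (generic copy $X$). The aggregate claim amount is $S=\sum_{j=1}^\infty X_j\mathbb{1}_{\{N\ge j\}}$. A $d$-variate FGM copula with parameters $\theta_{j_1\dots j_k}$ is $C(u_1,\dots,u_d)=\prod_{m=1}^d u_m\big(1+\sum_{k=2}^d\sum_{j_1<\dots<j_k}\theta_{j_1\dots j_k}\bar u_{j_1}\cdots\bar u_{j_k}\big)$, $\bar u=1-u$, with parameters such that $1+\sum_{k}\sum_{j_1<\dots<j_k}\theta_{j_1\dots j_k}\varepsilon_{j_1}\cdots\varepsilon_{j_k}\ge0$ for all $\varepsilon\in\{-1,1\}^d$. A CRM belongs to $\aleph^{FGM}$ if for every $k\in\mathbb{N}_1$, $k\le\sup A_N$, $F_{N,X_1,\dots,X_k}(n,x_1,\dots,x_k)=C_k(F_N(n),F_X(x_1),\dots,F_X(x_k))$ for a $(k+1)$-variate FGM copula $C_k$ with coordinates indexed $0,\dots,k$ (index $0$ for $N$). It belongs to $\aleph^{FGM*}$ if in addition $(N,X_1,\dots,X_k)\overset d=(N,X_{\pi(1)},\dots,X_{\pi(k)})$ for all such $k$ and all permutations $\pi$; then $\theta_{0j}=\theta_{01}$, $\theta_{ij}=\theta_{12}$, $\theta_{0ij}=\theta_{012}$ for all $1\le i<j$.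 For a random variable $Y$, $Y_{[1]}$, $Y_{[2]}$ denote the minimum and maximum of two iid copies of $Y$; $\mu_{Y_{[j]}}=E[Y_{[j]}]$, $\mu^{(2)}_{Y_{[j]}}=E[Y_{[j]}^2]$, and $\mu_{Y_{[j]}}^2$ means $(\mu_{Y_{[j]}})^2$; $\mu_N=E[N]$, $\mu_N^{(2)}=E[N^2]$; $\gamma_{N_{[j]}}(n)=\Pr(N_{[j]}=n)$. *)

(* Defs.v *)
From HB Require Import structures.
From mathcomp Require Import all_boot all_order all_algebra all_fingroup.
From mathcomp Require Import all_classical all_reals all_analysis.
Set Implicit Arguments. Unset Strict Implicit. Unset Printing Implicit Defensive.
Import Order.TTheory GRing.Theory Num.Theory.
Local Open Scope classical_set_scope.
Local Open Scope ring_scope.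

Section CRM.
Context {d : measure_display} {T : measurableType d} {R : realType}.
Implicit Types (P : probability T R) (N : T -> nat) (Y : T -> R).

Definition natRV N : T -> R := fun t => (N t)%:R.

Definition pmfN P N (n : nat) : R := fine (P [set t | N t = n]).
Definition cdfN P N (r : R) : R := fine (P [set t | (N t)%:R <= r]).
Definition cdfR P Y (x : R) : R := fine (P [set t | Y t <= x]).

Definition mean P Y : R := fine ('E_P[Y])%E.
Definition mom2 P Y : R := fine ('E_P[fun t => (Y t ^+ 2)%R])%E.
Definition var P Y : R := fine ('V_P[Y])%E.

(* minimum / maximum of two iid copies, realised on the product space (P \x P) *)
Definition ordmin Y : T * T -> R := fun z => Num.min (Y z.1) (Y z.2).
Definition ordmax Y : T * T -> R := fun z => Num.max (Y z.1) (Y z.2).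
Definition pmfNmin P N (n : nat) : R :=
  fine ((P \x P)%E [set z | minn (N z.1) (N z.2) = n]).
Definition pmfNmax P N (n : nat) : R :=
  fine ((P \x P)%E [set z | maxn (N z.1) (N z.2) = n]).

Definition aggS N (X : nat -> T -> R) : T -> R :=
  fun t => \sum_(1 <= j < (N t).+1) X j t.

Definition jcdf P N (X : nat -> T -> R) (k : nat) (f : 'I_k -> nat)
    (r : R) (x : 'I_k -> R) : R :=
  fine (P [set t | (N t)%:R <= r /\ forall i : 'I_k, X (f i) t <= x i]).

(* conditional expectation given (the discrete variable) N:
   E[Y | N](t) = E[Y 1_{N = N t}] / P(N = N t)  (a version of E[Y | sigma(N)]) *)
Definition condE P N Y : T -> R :=
  fun t => fine ('E_P[fun w => (Y w * (N w == N t)%:R)%R])%E / pmfN P N (N t).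
Definition condVar P N Y : T -> R :=
  fun t => condE P N (fun w => Y w ^+ 2) t - (condE P N Y t) ^+ 2.
Definition condCov P N Y (Z : T -> R) : T -> R :=
  fun t => condE P N (fun w => Y w * Z w) t - condE P N Y t * condE P N Z t.

End CRM.

(* (k+1)-variate FGM copula, coordinates indexed by 'I_k.+1 (0 <-> N),
   parameters theta_A for A with #|A| >= 2 *)
Definition fgm_copula {R : realType} (k : nat) (th : {set 'I_k.+1} -> R)
    (u : 'I_k.+1 -> R) : R :=
  (\prod_(m : 'I_k.+1) u m) *
  (1 + \sum_(A : {set 'I_k.+1} | (1 < #|A|)%N) th A * \prod_(j in A) (1 - u j)).

Definition fgm_admissible {R : realType} (k : nat) (th : {set 'I_k.+1} -> R) :=
  forall eps : 'I_k.+1 -> bool,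
    0 <= 1 + \sum_(A : {set 'I_k.+1} | (1 < #|A|)%N)
               th A * \prod_(j in A) (if eps j then 1 else -1).

Definition fgm_args {R : realType} (k : nat) (uN : R) (uX : 'I_k -> R)
    : 'I_k.+1 -> R :=
  fun i => match unlift ord0 i with None => uN | Some j => uX j end.

(* Main.v *)
(** The FGM density is polynomial in the marginal cdfs, so the probabilities
    P(N = n, X_i > a) and P(N = n, X_i > a, X_j > b) are explicit combinations
    of 1 - F and F (1 - F), where 2 F(a) (1 - F(a)) is the difference of the
    tails of the maximum and the minimum of two iid copies of X, and the jump
    of F_N (1 - F_N) at n is -(P(N_[2] = n) - P(N_[1] = n)) / 2.  A nonnegative
    variable is the pointwise limit of staircases h * #{k | h (k+1) < x}, and
    the expectation of a staircase (or of a product of two) is a linear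
    functional of the tail; dominated convergence therefore turns the tail
    identities into formulas for E[X_i; N = n], E[X_i^2; N = n] and
    E[X_i X_j; N = n].  Summing over n leaves only expectations of functions of
    N, all of which are combinations of N^k R_N^l with k = 1, 2 and l = 0, 1, 2;
    they are integrable because |R_n| = 2 |F_N(n) + F_N(n-1) - 1| <= 2. *)
Require Import Defs.
From HB Require Import structures.
From mathcomp Require Import all_boot all_order all_algebra all_fingroup.
From mathcomp Require Import all_classical all_reals all_analysis.
From mathcomp Require Import measurable_realfun.
From mathcomp Require Import ring lra zify.
Set Implicit Arguments. Unset Strict Implicit. Unset Printing Implicit Defensive.
Import numFieldNormedType.Exports.
Import Order.TTheory GRing.Theory Num.Theory.
Local Open Scope classical_set_scope.
Local Open Scope ring_scope.

(** The hypotheses describe the tuples (N, X_1, ..., X_k) in their given order, while the second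
    moment of S involves every pair of claims. Exchangeability moves X_i and X_j to the first two
    places of a tuple of length max(i, j), and letting the other thresholds tend to infinity leaves
    a law governed by C_1 or C_2. Comparing these two copulas is the delicate point: a degenerate
    marginal leaves the theta_01 of C_2 undetermined, so only its product with G (1 - G) F (1 - F)
    can be matched, and joint laws are written in terms of such products. Grid sums suit this form
    because a double sum of a product factors. Each factor F (1 - F) then contributes D / 2, which
    produces D^2 in the mixed moments, while X^2 is the product of X with itself, with tail
    threshold max(a, b). Integrability of S^2 is not assumed but obtained level by level. The
    decomposition of the variance is not quoted from a law of total variance: both sides are
    computed from the same finite list of moments and compared. *)

Local Notation intg P f := (integrable P setT (EFin \o f)).

(** * Real-valued expectations *)

Section Mean.
Context {d : measure_display} {T : measurableType d} {R : realType}.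
Variable P : probability T R.
Implicit Types (f g : T -> R) (b c : T -> bool).

(** Events are boolean predicates, so that intersections and complements become [&&] and [~~] and
    set identities reduce to case analysis. *)
Definition prob b : R := fine (P [set t | b t]).

Lemma mean_Rintegral f : mean P f = Rintegral P setT f.
Proof. by rewrite /mean unlock. Qed.

Lemma expectation_mean f : intg P f -> ('E_P[f] = (mean P f)%:E)%E.
Proof.
by move=> If; rewrite /mean fineK// unlock; exact: integrable_fin_num.
Qed.

Lemma intg_meas f : intg P f -> measurable_fun setT f.
Proof. by move=> /integrableP[/measurable_EFinP]. Qed.

Lemma intgD f g : intg P f -> intg P g -> intg P (fun t => f t + g t).
Proof. by move=> If Ig; exact: (integrableD measurableT If Ig). Qed.

Lemma intgZ k f : intg P f -> intg P (fun t => k * f t).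
Proof. by move=> If; exact: (integrableZl measurableT k If). Qed.

Lemma intg_le f g : measurable_fun setT f -> (forall t, `|f t| <= g t) ->
  intg P g -> intg P f.
Proof.
move=> mf fg; apply: le_integrable => //; first exact/measurable_EFinP.
by move=> t _ /=; rewrite lee_fin (le_trans (fg t)) ?ler_norm.
Qed.

Lemma intg_cst k : intg P (fun=> k).
Proof. exact: (finite_measure_integrable_cst P k). Qed.

Lemma intg_sum n (f : 'I_n -> T -> R) : (forall i, intg P (f i)) ->
  intg P (fun t => \sum_i f i t).
Proof.
move=> If; have := @integrable_sum _ _ _ P setT measurableT _ (index_enum 'I_n)
  xpredT (fun i t => (f i t)%:E) (fun i _ => If i).
by apply: eq_integrable => // t _ /=; rewrite sumEFin.
Qed.

Lemma meanD f g : intg P f -> intg P g ->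
  mean P (fun t => f t + g t) = mean P f + mean P g.
Proof. by move=> *; rewrite !mean_Rintegral RintegralD. Qed.

Lemma meanZ k f : intg P f -> mean P (fun t => k * f t) = k * mean P f.
Proof. by move=> *; rewrite !mean_Rintegral RintegralZl. Qed.

Lemma mean_sum n (f : 'I_n -> T -> R) : (forall i, intg P (f i)) ->
  mean P (fun t => \sum_i f i t) = \sum_i mean P (f i).
Proof.
elim: n f => [|n IH] f If.
  rewrite big_ord0 (_ : (fun t => _) = cst 0); last first.
    by apply/funext => t; rewrite big_ord0.
  by rewrite /mean expectation_cst.
rewrite big_ord_recl -IH; last by move=> i; exact: If.
rewrite -meanD//; last by apply: intg_sum => i; exact: If.
by congr mean; apply/funext => t; rewrite big_ord_recl.
Qed.

Lemma measurable_bool2R b : measurable_fun setT b ->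
  measurable_fun setT (fun t => (b t)%:R : R).
Proof.
move=> mb; rewrite (_ : (fun t => _) = (fun t => if b t then 1 else 0)).
  by apply: measurable_fun_ifT => //; exact: measurable_cst.
by apply/funext => t; case: (b t).
Qed.

Lemma measurable_boolset b : measurable_fun setT b -> measurable [set t | b t].
Proof.
move=> /(_ measurableT [set true]); rewrite setTI; exact.
Qed.

Lemma intg_bool b : measurable_fun setT b -> intg P (fun t => (b t)%:R).
Proof.
move=> mb; apply: (intg_le (g := fun=> 1)); last exact: intg_cst.
  exact: measurable_bool2R.
by move=> t; case: (b t); rewrite ?normr0 ?normr1.
Qed.

Lemma mean_bool b : measurable_fun setT b ->
  mean P (fun t => (b t)%:R) = prob b.
Proof.
move=> mb; rewrite /prob -expectation_indic; last exact: measurable_boolset.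
congr (fine (expectation _ _)); apply/funext => t; rewrite indicE.
by case: (boolP (b t)) => bt; [rewrite mem_set|rewrite memNset//; exact/negP].
Qed.

Lemma prob_setT : prob (fun=> true) = 1.
Proof.
rewrite /prob (_ : [set t | _] = setT); first by rewrite probability_setT.
by apply/seteqP; split.
Qed.

Lemma prob_split b c : measurable_fun setT b -> measurable_fun setT c ->
  prob b = prob (fun t => b t && c t) + prob (fun t => b t && ~~ c t).
Proof.
move=> mb mc; rewrite -!mean_bool//; last 2 first.
- by apply: measurable_and => //; exact: measurable_neg.
- by apply: measurable_and.
rewrite -meanD; last 2 first.
- by apply: intg_bool; apply: measurable_and.
- by apply: intg_bool; apply: measurable_and => //; exact: measurable_neg.
congr mean; apply/funext => t.
by case: (b t); case: (c t); rewrite /= ?addr0 ?add0r.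
Qed.

Lemma mean_ae_eq f g : measurable_fun setT f -> measurable_fun setT g ->
  {ae P, forall t, f t = g t} -> mean P f = mean P g.
Proof.
move=> mf mg fg; rewrite /mean unlock; congr fine.
apply: ae_eq_integral => //; [exact/measurable_EFinP..|].
by apply: filterS fg => t /= -> _.
Qed.

(** Dominated by [f ^+ 2 + g ^+ 2], since (|f| - |g|)^2 >= 0 bounds even twice the product. *)
Lemma intg_mul f g : measurable_fun setT f -> measurable_fun setT g ->
  intg P (fun t => f t ^+ 2) -> intg P (fun t => g t ^+ 2) ->
  intg P (fun t => f t * g t).
Proof.
move=> mf mg If Ig; apply: (intg_le (g := fun t => f t ^+ 2 + g t ^+ 2)).
- exact: measurable_funM.
- move=> t; rewrite normrM.
  rewrite -(real_normK (num_real (f t))) -(real_normK (num_real (g t))).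
  by have := sqr_ge0 (`|f t| - `|g t|); have := sqr_ge0 (`|f t|);
     have := sqr_ge0 (`|g t|); nra.
- exact: intgD.
Qed.

Lemma intg_sqrW f : measurable_fun setT f -> intg P (fun t => f t ^+ 2) ->
  intg P f.
Proof.
move=> mf If; have := @intg_mul f (fun=> 1) mf (measurable_cst _) If.
rewrite expr1n => /(_ (intg_cst 1)).
by congr integrable; apply/funext => t /=; rewrite mulr1.
Qed.

Lemma intg_bool_mul b f : measurable_fun setT b -> intg P f ->
  intg P (fun t => f t * (b t)%:R).
Proof.
move=> mb If; apply: (intg_le (g := fun t => `|f t|)).
- apply: measurable_funM; [exact: intg_meas|exact: measurable_bool2R].
- by move=> t; case: (b t); rewrite ?mulr1 ?mulr0 ?normr0.
- exact: integrable_norm.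
Qed.

Lemma variance_mean f : measurable_fun setT f -> intg P (fun t => f t ^+ 2) ->
  ('V_P[f] = (mean P (fun t => (f t ^+ 2)%R) - mean P f ^+ 2)%:E)%E.
Proof.
move=> mf If; have If1 := intg_sqrW mf If.
rewrite /variance covarianceE; last 3 first.
- exact/Lfun1_integrable.
- exact/Lfun1_integrable.
- exact/Lfun1_integrable.
by rewrite (expectation_mean If) (expectation_mean If1) -EFinM -EFinB.
Qed.

Lemma var_mean f : measurable_fun setT f -> intg P (fun t => f t ^+ 2) ->
  var P f = mom2 P f - mean P f ^+ 2.
Proof. by move=> mf If; rewrite /var variance_mean. Qed.

End Mean.

(** * Staircase approximation and tails *)

Section Staircase.
Context {R : realType}.
Implicit Types (h x : R) (n m : nat).

Definition staircase h n x : R := \sum_(k < n) h * (h * k.+1%:R < x)%R%:R.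

Lemma staircaseS h n x :
  staircase h n.+1 x = staircase h n x + h * (h * n.+1%:R < x)%R%:R.
Proof. by rewrite /staircase big_ord_recr. Qed.

Lemma staircase_ge0 h n x : 0 <= h -> 0 <= staircase h n x.
Proof. by move=> h0; apply: sumr_ge0 => k _; rewrite mulr_ge0. Qed.

Lemma staircase_max h n x : 0 <= h -> staircase h n x <= h * n%:R.
Proof.
move=> h0; elim: n => [|n IH]; first by rewrite /staircase big_ord0 mulr0.
rewrite staircaseS mulrSr mulrDr lerD// mulr1.
by case: (_ < _); rewrite ?mulr1 ?mulr0.
Qed.

Lemma staircase_le h n x : 0 <= h -> 0 <= x -> staircase h n x <= x.
Proof.
move=> h0 x0; elim: n => [|n IH]; first by rewrite /staircase big_ord0.
rewrite staircaseS; case: (ltP _ x) => hx; last by rewrite mulr0 addr0.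
rewrite mulr1; apply: (le_trans _ (ltW hx)).
by rewrite mulrSr mulrDr mulr1 lerD2r staircase_max.
Qed.

Lemma staircase_top h n x : 0 <= h -> h * n%:R < x -> staircase h n x = h * n%:R.
Proof.
move=> h0; elim: n => [|n IH] hx; first by rewrite /staircase big_ord0 mulr0.
rewrite staircaseS hx mulr1 IH ?mulrSr ?mulrDr ?mulr1//.
by apply: le_lt_trans hx; rewrite ler_wpM2l// ler_nat.
Qed.

(** Below its cap the staircase undershoots by at most one step: if [x] exceeds [h * n%:R], all [n]
    grid points below are counted, and they already give [x - h]. *)
Lemma staircase_ge h n x : 0 <= h -> x <= h * n.+1%:R -> x - h <= staircase h n x.
Proof.
move=> h0; elim: n => [|n IH] hx.
  by rewrite /staircase big_ord0 subr_le0 -[leRHS]mulr1.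
case: (leP x (h * n.+1%:R)) => hn.
  by rewrite staircaseS (le_trans (IH hn))// lerDl mulr_ge0.
rewrite staircase_top// lerBlDr; move: hx.
by rewrite -[in X in X -> _]natr1 mulrDr mulr1.
Qed.

Definition mesh m : R := m.+1%:R^-1.
(** With (m+1)^2 steps of size 1/(m+1) the range m+1 grows while the mesh shrinks, so every fixed
    [x] is eventually under the cap. *)
Definition approx m x := staircase (mesh m) (m.+1 ^ 2) x.

Lemma mesh_ge0 m : 0 <= mesh m. Proof. by rewrite invr_ge0. Qed.

Lemma approx_ge0 m x : 0 <= approx m x.
Proof. exact/staircase_ge0/mesh_ge0. Qed.

Lemma approx_le m x : 0 <= x -> approx m x <= x.
Proof. exact/staircase_le/mesh_ge0. Qed.

Lemma approx_cvg x : 0 <= x -> approx m x @[m --> \oo] --> x.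
Proof.
move=> x0.
have hc : mesh m @[m --> \oo] --> 0 by exact: cvg_harmonic.
have lc : x - mesh m @[m --> \oo] --> x.
  by rewrite -[X in _ --> X]subr0; apply: cvgB => //; exact: cvg_cst.
apply: (squeeze_cvgr _ lc (@cvg_cst _ _ _ _ _)); near=> m.
rewrite approx_le// andbT; apply: staircase_ge; first exact: mesh_ge0.
apply: (@le_trans _ _ m.+1%:R).
  by near: m; exists (Num.truncn x).+1 => // m /= mx;
   rewrite (le_trans (ltW (truncnS_gt x)))// ler_nat ltnW.
rewrite /mesh mulrC ler_pdivlMr ?ltr0n// -natrM ler_nat; nia.
Unshelve. all: by end_near. Qed.

Lemma measurable_approx m : measurable_fun setT (approx m).
Proof.
apply: measurable_sum => k; apply: measurable_funM; first exact: measurable_cst.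
apply: measurable_bool2R; apply: measurable_fun_ltr => //; exact: measurable_cst.
Qed.

(** Riemann sums over [0, m+1], and for [sum2] over its square: discrete versions of the integral of
    a tail over the half-line and the quadrant. *)
Definition sum1 m (G : R -> R) : R :=
  \sum_(k < m.+1 ^ 2) mesh m * G (mesh m * k.+1%:R).
Definition sum2 m (G : R -> R -> R) : R :=
  \sum_(k < m.+1 ^ 2) \sum_(l < m.+1 ^ 2)
    mesh m ^+ 2 * G (mesh m * k.+1%:R) (mesh m * l.+1%:R).

Lemma sum1D m G H : sum1 m (fun a => G a + H a) = sum1 m G + sum1 m H.
Proof. by rewrite /sum1 -big_split; apply: eq_bigr => k _; rewrite mulrDr. Qed.

Lemma sum1Z m c G : sum1 m (fun a => c * G a) = c * sum1 m G.
Proof. by rewrite /sum1 mulr_sumr; apply: eq_bigr => k _; rewrite mulrCA. Qed.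

Lemma sum2D m G H :
  sum2 m (fun a b => G a b + H a b) = sum2 m G + sum2 m H.
Proof.
rewrite /sum2 -big_split; apply: eq_bigr => k _.
by rewrite -big_split; apply: eq_bigr => l _; rewrite mulrDr.
Qed.

Lemma sum2Z m c G : sum2 m (fun a b => c * G a b) = c * sum2 m G.
Proof.
rewrite /sum2 mulr_sumr; apply: eq_bigr => k _.
by rewrite mulr_sumr; apply: eq_bigr => l _; rewrite mulrCA.
Qed.

(** This factorisation is what turns limits of two-variable tails into products of means. *)
Lemma sum2M m G H : sum2 m (fun a b => G a * H b) = sum1 m G * sum1 m H.
Proof.
rewrite /sum1 mulr_suml; apply: eq_bigr => k _.
by rewrite mulr_sumr; apply: eq_bigr => l _; ring.
Qed.

End Staircase.

Section TailMoments.
Context {d : measure_display} {T : measurableType d} {R : realType}.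
Variable P : probability T R.
Implicit Types (Y Z : T -> R) (b c : T -> bool).

Lemma mean_approx b Y m : measurable_fun setT b -> measurable_fun setT Y ->
  mean P (fun t => approx m (Y t) * (b t)%:R) =
  sum1 m (fun a => prob P (fun t => b t && (a < Y t))).
Proof.
move=> mb mY.
have mab a : measurable_fun setT (fun t => b t && (a < Y t)).
  by apply: measurable_and => //; apply: measurable_fun_ltr => //;
     exact: measurable_cst.
rewrite /sum1 (eq_bigr (fun k : 'I_(m.+1 ^ 2) => mean P (fun t => mesh m *
    (b t && (mesh m * k.+1%:R < Y t))%:R))).
  rewrite -mean_sum; last by move=> k; apply: intgZ; exact: intg_bool.
  congr mean; apply/funext => t; rewrite /approx /staircase mulr_suml.
  by apply: eq_bigr => k _; rewrite -mulrA -natrM mulnb andbC.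
by move=> k _; rewrite meanZ ?mean_bool//; exact: intg_bool.
Qed.

Lemma mean_approx2 b Y Z m :
  measurable_fun setT b -> measurable_fun setT Y -> measurable_fun setT Z ->
  mean P (fun t => approx m (Y t) * approx m (Z t) * (b t)%:R) =
  sum2 m (fun a a' => prob P (fun t => b t && ((a < Y t) && (a' < Z t)))).
Proof.
move=> mb mY mZ.
have mab a a' : measurable_fun setT (fun t => b t && ((a < Y t) && (a' < Z t))).
  by apply: measurable_and => //; apply: measurable_and => //;
     apply: measurable_fun_ltr => //; exact: measurable_cst.
rewrite /sum2 (eq_bigr (fun k : 'I_(m.+1 ^ 2) => mean P (fun t =>
   \sum_(l < m.+1 ^ 2) mesh m ^+ 2 *
    (b t && ((mesh m * k.+1%:R < Y t) && (mesh m * l.+1%:R < Z t)))%:R))).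
  rewrite -mean_sum; last first.
    by move=> k; apply: intg_sum => l; apply: intgZ; exact: intg_bool.
  congr mean; apply/funext => t; rewrite /approx /staircase mulr_suml mulr_suml.
  apply: eq_bigr => k _; rewrite mulr_sumr mulr_suml.
  by apply: eq_bigr => l _; rewrite -!mulnb !natrM; ring.
move=> k _; rewrite mean_sum; last by move=> l; apply: intgZ; exact: intg_bool.
by apply: eq_bigr => l _; rewrite meanZ ?mean_bool//; exact: intg_bool.
Qed.

(** Convergence and domination are only almost sure, because the claims are nonnegative only off a
    null set. *)
Lemma mean_dominated (f_ : nat -> T -> R) (f g : T -> R) :
  (forall m, measurable_fun setT (f_ m)) -> measurable_fun setT f ->
  {ae P, forall t, f_ m t @[m --> \oo] --> f t} ->
  {ae P, forall t, forall m, `|f_ m t| <= g t} -> intg P g ->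
  mean P (f_ m) @[m --> \oo] --> mean P f.
Proof.
move=> mf_ mf cf bf Ig.
have [||||If _ +] := @dominated_convergence _ _ _ P setT measurableT
    (fun m => EFin \o f_ m) (EFin \o f) (EFin \o g) _ _ _ Ig _.
- by move=> m; exact/measurable_EFinP.
- exact/measurable_EFinP.
- by apply: filterS cf => t ct _; apply: cvg_EFin => //; exact: nearW.
- by apply: filterS bf => t bt m _; rewrite lee_fin.
rewrite /mean unlock => h; apply: fine_cvg.
rewrite fineK//; exact: integrable_fin_num.
Qed.

Lemma mean_tail_cvg b Y : measurable_fun setT b -> intg P Y ->
  {ae P, forall t, 0 <= Y t} ->
  sum1 m (fun a => prob P (fun t => b t && (a < Y t))) @[m --> \oo]
    --> mean P (fun t => Y t * (b t)%:R).
Proof.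
move=> mb IY Y0; have mY := intg_meas IY.
rewrite (_ : (fun m => _) =
   (fun m => mean P (fun t => approx m (Y t) * (b t)%:R))); last first.
  by apply/funext => m; rewrite mean_approx.
have mb' := @measurable_bool2R _ _ R _ mb.
apply: (mean_dominated (g := fun t => `|Y t|)).
- move=> m; apply: measurable_funM => //.
  exact: (measurableT_comp (measurable_approx m)).
- exact: measurable_funM.
- apply: filterS Y0 => t Y0; apply: cvgMl; exact: approx_cvg.
- apply: filterS Y0 => t Y0 m; rewrite normrM (ger0_norm (approx_ge0 _ _)).
  rewrite ger0_norm//; case: (b t); rewrite ?mulr0// ?mulr1.
  by rewrite (le_trans (approx_le _ Y0)) ?ler_norm.
- exact: integrable_norm.
Qed.

(** Taken with [Y = Z] it gives second moments, with distinct claims it gives mixed moments. *)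
Lemma mean_tail2_cvg b Y Z : measurable_fun setT b ->
  measurable_fun setT Y -> measurable_fun setT Z ->
  intg P (fun t => Y t * Z t) ->
  {ae P, forall t, 0 <= Y t} -> {ae P, forall t, 0 <= Z t} ->
  sum2 m (fun a a' => prob P (fun t => b t && ((a < Y t) && (a' < Z t))))
    @[m --> \oo] --> mean P (fun t => Y t * Z t * (b t)%:R).
Proof.
move=> mb mY mZ IYZ Y0 Z0.
rewrite (_ : (fun m => _) = (fun m =>
   mean P (fun t => approx m (Y t) * approx m (Z t) * (b t)%:R))); last first.
  by apply/funext => m; rewrite mean_approx2.
have mb' := @measurable_bool2R _ _ R _ mb.
apply: (mean_dominated (g := fun t => `|Y t * Z t|)).
- move=> m; apply: measurable_funM => //; apply: measurable_funM.
    exact: (measurableT_comp (measurable_approx m)).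
  exact: (measurableT_comp (measurable_approx m)).
- by apply: measurable_funM => //; exact: measurable_funM.
- apply: filterS2 Y0 Z0 => t Y0 Z0; apply: cvgMl.
  by apply: cvgM; exact: approx_cvg.
- apply: filterS2 Y0 Z0 => t Y0 Z0 m.
  rewrite !normrM !(ger0_norm (approx_ge0 _ _)) (ger0_norm (ler0n _ _)).
  rewrite (ger0_norm Y0) (ger0_norm Z0).
  case: (b t); rewrite ?mulr0 ?mulr1 ?mulr_ge0//.
  by rewrite ler_pM ?approx_ge0 ?approx_le.
- exact: integrable_norm.
Qed.

End TailMoments.

(** * Counting variables and iid extremes *)

Lemma measurable_nat {d} {T : measurableType d} (N : T -> nat) :
  (forall n, measurable [set t | N t = n]) -> measurable_fun setT N.
Proof.
move=> mN _ B _; rewrite setTI.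
rewrite (_ : _ @^-1` _ = \bigcup_(n in B) [set t | N t = n]).
  by apply: bigcup_measurable => n _; exact: mN.
by apply/seteqP; split => [t Bt|t [n Bn /= Nt]]; [exists (N t)|rewrite /preimage /= Nt].
Qed.

Lemma measurable_fun_nat {d d'} {T : measurableType d} {U : measurableType d'}
  (N : T -> nat) (f : nat -> U) : measurable_fun setT N ->
  measurable_fun setT (fun t => f (N t)).
Proof.
move=> mN; have mf : measurable_fun setT f by [].
exact: (measurableT_comp mf mN).
Qed.

Section Discrete.
Context {d : measure_display} {T : measurableType d} {R : realType}.
Variable P : probability T R.
Implicit Types (b c : T -> bool) (N : T -> nat) (Y : T -> R).

Lemma eq_prob b c : b =1 c -> prob P b = prob P c.
Proof. by move=> /funext ->. Qed.

Lemma prob_ge0 b : 0 <= prob P b.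
Proof. exact: fine_ge0. Qed.

Lemma prob_neg b : measurable_fun setT b -> prob P (fun t => ~~ b t) = 1 - prob P b.
Proof.
move=> mb; have := prob_split P (measurable_cst true) mb.
by rewrite prob_setT /= => ->; rewrite addrAC subrr add0r.
Qed.

Lemma prob_le1 b : measurable_fun setT b -> prob P b <= 1.
Proof. by move=> mb; rewrite -subr_ge0 -prob_neg// prob_ge0. Qed.

Lemma prob_eqn_and N n c : measurable_fun setT N -> measurable_fun setT c ->
  prob P (fun t => (N t == n) && c t) =
  prob P (fun t => (N t <= n)%N && c t) - prob P (fun t => (N t < n)%N && c t).
Proof.
move=> mN mc; rewrite (@prob_split _ _ _ P (fun t => (N t <= n)%N && c t)
   (fun t => (N t < n)%N)); last 2 first.
- by apply: measurable_and => //; exact: (measurable_fun_nat (fun k => k <= n)%N).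
- exact: (measurable_fun_nat (fun k => k < n)%N).
rewrite (@eq_prob (fun t => _ && (N t < n)%N) (fun t => (N t < n)%N && c t)).
  rewrite addrAC subrr add0r; apply: eq_prob => t.
  by case: (c t); rewrite ?andbT ?andbF// -leqNgt -eqn_leq.
by move=> t; case: (c t); rewrite ?andbT ?andbF//; case: ltngtP.
Qed.

Lemma prob_eqn N n : measurable_fun setT N ->
  prob P (fun t => N t == n) =
  prob P (fun t => (N t <= n)%N) - prob P (fun t => (N t < n)%N).
Proof.
move=> mN; have := @prob_eqn_and N n (fun=> true) mN (measurable_cst _).
rewrite (@eq_prob (fun t => _ && true) (fun t => N t == n)); last first.
  by move=> t; rewrite andbT.
rewrite (@eq_prob (fun t => _ && true) (fun t => N t <= n)%N); last first.
  by move=> t; rewrite andbT.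
rewrite (@eq_prob (fun t => _ && true) (fun t => N t < n)%N)// => t.
by rewrite andbT.
Qed.

Lemma pmfN_prob N n : pmfN P N n = prob P (fun t => N t == n).
Proof.
by rewrite /pmfN /prob; congr (fine (P _)); apply/seteqP; split => t /= /eqP.
Qed.

Lemma cdfN_nat N n : cdfN P N n%:R = prob P (fun t => (N t <= n)%N).
Proof. by apply: eq_prob => t; rewrite ler_nat. Qed.

(** At [n = 0] the threshold is -1 and both events are empty, so the left limit of the cdf needs no
    separate case. *)
Lemma cdfN_pred N n : cdfN P N (n%:R - 1) = prob P (fun t => (N t < n)%N).
Proof. by apply: eq_prob => t; rewrite lerBrDr natr1 ler_nat. Qed.

Lemma pmfN_cdfN N n : measurable_fun setT N ->
  pmfN P N n = cdfN P N n%:R - cdfN P N (n%:R - 1).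
Proof. by move=> mN; rewrite cdfN_nat cdfN_pred pmfN_prob prob_eqn. Qed.

Lemma prob_tail Y a : measurable_fun setT Y ->
  prob P (fun t => a < Y t) = 1 - cdfR P Y a.
Proof.
move=> mY; rewrite -[cdfR P Y a]/(prob P (fun t => Y t <= a)) -prob_neg.
  by apply: eq_prob => t; rewrite ltNge.
by apply: measurable_fun_ler => //; exact: measurable_cst.
Qed.

End Discrete.

(** * Laws and integrability of the two iid extremes on the product space *)

Section Extremes.
Context {d : measure_display} {T : measurableType d} {R : realType}.
Variable P : probability T R.
Implicit Types (b c : T -> bool) (N : T -> nat) (Y : T -> R).
Let PP : probability (T * T)%type R := (P \x P)%E.

Lemma prob_prod b c : measurable_fun setT b -> measurable_fun setT c ->
  prob PP (fun z => b z.1 && c z.2) = prob P b * prob P c.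
Proof.
move=> /measurable_boolset mb /measurable_boolset mc.
rewrite /prob -fineM ?fin_num_measure// -product_measure1E//; congr (fine (_ _)).
by apply/seteqP; split => z /= => [/andP[]//|[bz cz]]; apply/andP.
Qed.

Lemma measurable_fst_comp {d'} {U : measurableType d'} (f : T -> U) :
  measurable_fun setT f -> measurable_fun setT (fun z : T * T => f z.1).
Proof. by move=> mf; exact: (measurableT_comp mf measurable_fst). Qed.

Lemma measurable_snd_comp {d'} {U : measurableType d'} (f : T -> U) :
  measurable_fun setT f -> measurable_fun setT (fun z : T * T => f z.2).
Proof. by move=> mf; exact: (measurableT_comp mf measurable_snd). Qed.

(** The cdf of the maximum is the square of that of N, and its jump factors as a difference of
    squares. *)
Lemma pmfNmaxE N n : measurable_fun setT N ->
  pmfNmax P N n = pmfN P N n * (cdfN P N n%:R + cdfN P N (n%:R - 1)).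
Proof.
move=> mN; pose M (z : T * T) := maxn (N z.1) (N z.2).
have mM : measurable_fun setT M.
  by apply: measurable_fun_maxn; [exact: measurable_fst_comp|exact: measurable_snd_comp].
have -> : pmfNmax P N n = prob PP (fun z => M z == n).
  by rewrite /pmfNmax /prob; congr (fine (_ _)); apply/seteqP; split => z /= /eqP.
rewrite pmfN_cdfN// prob_eqn// cdfN_nat cdfN_pred.
have -> : prob PP (fun z => (M z <= n)%N) = prob P (fun t => N t <= n)%N ^+ 2.
  rewrite expr2 -prob_prod; first by apply: eq_prob => z; rewrite geq_max.
  + exact: (measurable_fun_nat (fun k => k <= n)%N).
  + exact: (measurable_fun_nat (fun k => k <= n)%N).
have -> : prob PP (fun z => (M z < n)%N) = prob P (fun t => N t < n)%N ^+ 2.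
  rewrite expr2 -prob_prod; first by apply: eq_prob => z; rewrite gtn_max.
  + exact: (measurable_fun_nat (fun k => k < n)%N).
  + exact: (measurable_fun_nat (fun k => k < n)%N).
ring.
Qed.

(** Same argument with the survival function squared. Subtracting from [pmfNmaxE] gives twice the
    jump of F^2 - F, which ties these pmfs to the FGM term F (1 - F). *)
Lemma pmfNminE N n : measurable_fun setT N ->
  pmfNmin P N n = pmfN P N n * (2 - cdfN P N n%:R - cdfN P N (n%:R - 1)).
Proof.
move=> mN; pose M (z : T * T) := minn (N z.1) (N z.2).
have mM : measurable_fun setT M.
  (* Measurability reduces to sums, differences and maxima; the truncated subtraction is exact
     because the maximum never exceeds the sum. *)
  have -> : M = fun z => (N z.1 + N z.2 - maxn (N z.1) (N z.2))%N.
    by apply/funext => z; rewrite /M; lia.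
  have m1 : measurable_fun setT (fun z : T * T => N z.1) by exact: measurable_fst_comp.
  have m2 : measurable_fun setT (fun z : T * T => N z.2) by exact: measurable_snd_comp.
  apply: measurable_fun_subn; first exact: measurable_fun_addn.
  exact: measurable_fun_maxn.
have -> : pmfNmin P N n = prob PP (fun z => M z == n).
  by rewrite /pmfNmin /prob; congr (fine (_ _)); apply/seteqP; split => z /= /eqP.
rewrite pmfN_cdfN// prob_eqn// cdfN_nat cdfN_pred.
have m1 := @measurable_fun_nat _ _ _ _ _ (fun k => n < k)%N mN.
have m2 := @measurable_fun_nat _ _ _ _ _ (fun k => n <= k)%N mN.
have mle := @measurable_fun_nat _ _ _ _ _ (fun k => k <= n)%N mN.
have mlt := @measurable_fun_nat _ _ _ _ _ (fun k => k < n)%N mN.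
have -> : prob PP (fun z => (M z <= n)%N) = 1 - (1 - prob P (fun t => N t <= n)%N) ^+ 2.
  rewrite -prob_neg// (@eq_prob _ _ _ P _ (fun t => n < N t)%N); last first.
    by move=> t; rewrite ltnNge.
  rewrite expr2 -prob_prod// -prob_neg.
    by apply: eq_prob => z; rewrite -leq_min ltnNge negbK.
  by apply: measurable_and; [exact: (measurable_fst_comp m1)|exact: (measurable_snd_comp m1)].
have -> : prob PP (fun z => (M z < n)%N) = 1 - (1 - prob P (fun t => N t < n)%N) ^+ 2.
  rewrite -prob_neg// (@eq_prob _ _ _ P _ (fun t => n <= N t)%N); last first.
    by move=> t; rewrite -leqNgt.
  rewrite expr2 -prob_prod// -prob_neg.
    by apply: eq_prob => z; rewrite -leq_min -ltnNge.
  by apply: measurable_and; [exact: (measurable_fst_comp m2)|exact: (measurable_snd_comp m2)].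
ring.
Qed.

Lemma prob_tail_max Y a : measurable_fun setT Y ->
  prob PP (fun z => a < ordmax Y z) = 1 - cdfR P Y a ^+ 2.
Proof.
move=> mY; have mb : measurable_fun setT (fun t => Y t <= a).
  by apply: measurable_fun_ler => //; exact: measurable_cst.
rewrite -[cdfR P Y a]/(prob P (fun t => Y t <= a)) expr2 -prob_prod//.
rewrite -prob_neg.
  by apply: eq_prob => z; rewrite /ordmax -ge_max ltNge.
by apply: measurable_and; [exact: (measurable_fst_comp mb)|exact: (measurable_snd_comp mb)].
Qed.

Lemma prob_tail_min Y a : measurable_fun setT Y ->
  prob PP (fun z => a < ordmin Y z) = (1 - cdfR P Y a) ^+ 2.
Proof.
move=> mY; have mb : measurable_fun setT (fun t => a < Y t).
  by apply: measurable_fun_ltr => //; exact: measurable_cst.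
rewrite -prob_tail// expr2 -prob_prod//.
by apply: eq_prob => z; rewrite /ordmin lt_min.
Qed.

Lemma measurable_ordmax Y : measurable_fun setT Y ->
  measurable_fun setT (ordmax Y).
Proof.
move=> mY; apply: measurable_maxr; [exact: measurable_fst_comp|exact: measurable_snd_comp].
Qed.

Lemma measurable_ordmin Y : measurable_fun setT Y ->
  measurable_fun setT (ordmin Y).
Proof.
move=> mY; apply: measurable_minr; [exact: measurable_fst_comp|exact: measurable_snd_comp].
Qed.

Lemma integral_fst (f : T -> \bar R) : measurable_fun setT f ->
  (forall t, 0 <= f t)%E ->
  (\int[PP]_z f z.1 = \int[P]_t f t)%E.
Proof.
move=> mf f0; rewrite (fubini_tonelli1 (fun z : T * T => f z.1)) //=.
- apply: eq_integral => t _; rewrite /fubini_F /= integral_cst//.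
  by rewrite -[RHS]mule1; congr (_ * _)%E; exact: probability_setT.
- exact: measurable_fst_comp.
Qed.

Lemma integral_snd (f : T -> \bar R) : measurable_fun setT f ->
  (forall t, 0 <= f t)%E ->
  (\int[PP]_z f z.2 = \int[P]_t f t)%E.
Proof.
move=> mf f0; rewrite (fubini_tonelli2 (fun z : T * T => f z.2)) //=.
- apply: eq_integral => t _; rewrite /fubini_G /= integral_cst//.
  by rewrite -[RHS]mule1; congr (_ * _)%E; exact: probability_setT.
- exact: measurable_snd_comp.
Qed.

Lemma intg_fst Y : intg P Y -> intg PP (fun z => Y z.1).
Proof.
move=> IY; have mY := intg_meas IY; apply/integrableP; split.
  by apply/measurable_EFinP; exact: measurable_fst_comp.
rewrite (@integral_fst (fun t => `|(Y t)%:E|%E))//.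
- by case/integrableP: IY.
- by apply: measurableT_comp => //; exact/measurable_EFinP.
Qed.

Lemma intg_snd Y : intg P Y -> intg PP (fun z => Y z.2).
Proof.
move=> IY; have mY := intg_meas IY; apply/integrableP; split.
  by apply/measurable_EFinP; exact: measurable_snd_comp.
rewrite (@integral_snd (fun t => `|(Y t)%:E|%E))//.
- by case/integrableP: IY.
- by apply: measurableT_comp => //; exact/measurable_EFinP.
Qed.

Lemma intg_norm_sum Y : intg P Y -> intg PP (fun z => `|Y z.1| + `|Y z.2|).
Proof.
move=> IY; apply: intgD; apply: integrable_norm => //; [exact: intg_fst|exact: intg_snd].
Qed.

Lemma ordmax_norm_le Y z : `|ordmax Y z| <= `|Y z.1| + `|Y z.2|.
Proof.
by rewrite /ordmax; case: (leP (Y z.1) (Y z.2)) => _; rewrite ?lerDl ?lerDr.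
Qed.

Lemma ordmin_norm_le Y z : `|ordmin Y z| <= `|Y z.1| + `|Y z.2|.
Proof.
by rewrite /ordmin; case: (leP (Y z.1) (Y z.2)) => _; rewrite ?lerDl ?lerDr.
Qed.

Lemma intg_ordmax Y : intg P Y -> intg PP (ordmax Y).
Proof.
move=> IY; apply: (intg_le _ _ (intg_norm_sum IY)); last exact: ordmax_norm_le.
exact: measurable_ordmax (intg_meas IY).
Qed.

Lemma intg_ordmin Y : intg P Y -> intg PP (ordmin Y).
Proof.
move=> IY; apply: (intg_le _ _ (intg_norm_sum IY)); last exact: ordmin_norm_le.
exact: measurable_ordmin (intg_meas IY).
Qed.

Lemma intg_ordmax_sqr Y : measurable_fun setT Y -> intg P (fun t => Y t ^+ 2) ->
  intg PP (fun z => ordmax Y z ^+ 2).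
Proof.
move=> mY IY; apply: (intg_le _ _ (intg_norm_sum IY)).
  by apply: measurable_funX; exact: measurable_ordmax.
move=> z; rewrite /ordmax; case: (leP (Y z.1) (Y z.2)) => _; rewrite ?lerDl ?lerDr//.
Qed.

Lemma intg_ordmin_sqr Y : measurable_fun setT Y -> intg P (fun t => Y t ^+ 2) ->
  intg PP (fun z => ordmin Y z ^+ 2).
Proof.
move=> mY IY; apply: (intg_le _ _ (intg_norm_sum IY)).
  by apply: measurable_funX; exact: measurable_ordmin.
move=> z; rewrite /ordmin; case: (leP (Y z.1) (Y z.2)) => _; rewrite ?lerDl ?lerDr//.
Qed.

(** The exceptional set lies in the union of two strips, each a product with one null factor. *)
Lemma ae_prod_ge0 Y : measurable_fun setT Y -> {ae P, forall t, 0 <= Y t} ->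
  {ae PP, forall z, 0 <= Y z.1 /\ 0 <= Y z.2}.
Proof.
move=> mY Y0.
have mb : measurable_fun setT (fun t => Y t < 0).
  by apply: measurable_fun_ltr => //; exact: measurable_cst.
have mA := measurable_boolset mb.
have PA : P [set t | Y t < 0] = 0%E.
  apply/negligibleP => //; apply: negligibleS Y0 => t /= Yt.
  by rewrite leNgt Yt.
have mA1 : measurable ([set t | Y t < 0] `*` setT : set (T * T)) by exact: measurableX.
have mA2 : measurable (setT `*` [set t | Y t < 0] : set (T * T)) by exact: measurableX.
have N1 : PP.-negligible ([set t | Y t < 0] `*` setT).
  exists ([set t | Y t < 0] `*` setT); split => //.
  by rewrite /PP /= product_measure1E//; apply/eqP; rewrite mule_eq0; apply/orP; left; exact/eqP.
have N2 : PP.-negligible (setT `*` [set t | Y t < 0]).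
  exists (setT `*` [set t | Y t < 0]); split => //.
  by rewrite /PP /= product_measure1E//; apply/eqP; rewrite mule_eq0; apply/orP; right; exact/eqP.
apply: (negligibleS _ (negligibleU N1 N2)) => z /= /not_andP[] /negP.
  by rewrite -ltNge => h; left; split.
by rewrite -ltNge => h; right; split.
Qed.

End Extremes.

(** * FGM copulas and their marginals *)

Section FGM.
Context {R : realType}.

Lemma fgm_args0 k (a : R) (x : 'I_k -> R) : fgm_args a x ord0 = a.
Proof. by rewrite /fgm_args unlift_none. Qed.

Lemma fgm_args_lift k (a : R) (x : 'I_k -> R) i : fgm_args a x (lift ord0 i) = x i.
Proof. by rewrite /fgm_args liftK. Qed.

Lemma big_sets_I2 (F : {set 'I_2} -> R) :
  \sum_(A : {set 'I_2} | (1 < #|A|)%N) F A = F [set ord0; ord_max]%SET.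
Proof.
apply: big_pred1 => A /=; apply/idP/eqP => [|->]; last by rewrite cards2.
rewrite -sum1_card big_mkcond !big_ord_recl big_ord0 => cA.
apply/setP => i; rewrite !inE; move: cA.
case: (boolP (ord0 \in A)) => A0; case: (boolP (lift ord0 ord0 \in A)) => // A1 _.
have [->|->] : i = ord0 \/ i = lift ord0 ord0.
  by case: i => [[|[|i]] Hi]; [left|right|]; try exact: val_inj; exfalso; lia.
- by rewrite A0.
- by rewrite A1.
Qed.

Lemma fgm_copula2 (th : {set 'I_2} -> R) a (x : 'I_1 -> R) :
  fgm_copula th (fgm_args a x) =
  a * x ord0 * (1 + th [set ord0; ord_max]%SET * (1 - a) * (1 - x ord0)).
Proof.
rewrite /fgm_copula big_sets_I2 !big_ord_recl big_ord0.
rewrite big_setU1 ?big_set1 ?inE//= fgm_args0 fgm_args_lift.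
have -> : ord_max = lift ord0 ord0 :> 'I_2 by exact: val_inj.
rewrite fgm_args_lift; ring.
Qed.

Lemma big_sets_I3 (F : {set 'I_3} -> R) :
  \sum_(A : {set 'I_3} | (1 < #|A|)%N) F A =
  F [set inord 0; inord 1]%SET + F [set inord 0; inord 2]%SET
  + F [set inord 1; inord 2]%SET + F [set: 'I_3]%SET.
Proof.
have E0 : inord 0 = ord0 :> 'I_3 by apply: val_inj; rewrite /= inordK.
have E1 : inord 1 = lift ord0 ord0 :> 'I_3 by apply: val_inj; rewrite /= inordK.
have E2 : inord 2 = lift ord0 (lift ord0 ord0) :> 'I_3.
  by apply: val_inj; rewrite /= inordK.
rewrite E0 E1 E2; set o1 : 'I_3 := lift ord0 ord0.
set o2 : 'I_3 := lift ord0 (lift ord0 ord0).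
pose s01 : {set 'I_3} := [set ord0; o1]%SET.
pose s02 : {set 'I_3} := [set ord0; o2]%SET.
pose s12 : {set 'I_3} := [set o1; o2]%SET.
(* A subset of three indices is encoded by three membership bits, so that equality and cardinality
   become boolean computations and the four admissible sets can be split off one by one. *)
have eqS (A B : {set 'I_3}) : (A == B) = [&& (ord0 \in A) == (ord0 \in B),
    (o1 \in A) == (o1 \in B) & (o2 \in A) == (o2 \in B)].
  apply/eqP/and3P => [->//|[/eqP h0 /eqP h1 /eqP h2]]; apply/setP => i.
  suff [->|[->|->]] : i = ord0 \/ i = o1 \/ i = o2 by [].
  by case: i => [[|[|[|i]]] Hi];
    [left|right; left|right; right|]; try exact: val_inj; exfalso; lia.
have cS (A : {set 'I_3}) : #|A| = ((ord0 \in A) + (o1 \in A) + (o2 \in A))%N.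
  rewrite -sum1_card big_mkcond !big_ord_recl big_ord0 /=.
  by rewrite -/o1 -/o2; case: (ord0 \in A); case: (o1 \in A); case: (o2 \in A).
rewrite (bigD1 s01) /=; last by rewrite cS !inE.
rewrite (bigD1 s02) /=; last by rewrite cS eqS !inE.
rewrite (bigD1 s12) /=; last by rewrite cS !eqS !inE.
rewrite (bigD1 [set: 'I_3]%SET) /=; last by rewrite cS !eqS !inE.
rewrite big_pred0 ?addr0 ?addrA// => A.
by rewrite cS !eqS !inE; case: (ord0 \in A); case: (o1 \in A); case: (o2 \in A).
Qed.

Lemma fgm_copula3 (th : {set 'I_3} -> R) a (x : 'I_2 -> R) :
  fgm_copula th (fgm_args a x) =
  a * x ord0 * x ord_max * (1 + th [set inord 0; inord 1]%SET * (1 - a) * (1 - x ord0)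
   + th [set inord 0; inord 2]%SET * (1 - a) * (1 - x ord_max)
   + th [set inord 1; inord 2]%SET * (1 - x ord0) * (1 - x ord_max)
   + th [set: 'I_3]%SET * (1 - a) * (1 - x ord0) * (1 - x ord_max)).
Proof.
have E0 : inord 0 = ord0 :> 'I_3 by apply: val_inj; rewrite /= inordK.
have E1 : inord 1 = lift ord0 ord0 :> 'I_3 by apply: val_inj; rewrite /= inordK.
have E2 : inord 2 = lift ord0 ord_max :> 'I_3 by apply: val_inj; rewrite /= inordK.
have E3 : lift ord0 ord0 = ord_max :> 'I_2 by apply: val_inj.
rewrite /fgm_copula big_sets_I3 !E0 !E1 !E2.
have prodT u : \prod_(j in [set: 'I_3]%SET) (1 - u j) = \prod_j (1 - u j) :> R.
  by apply: eq_bigl => i; rewrite inE.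
rewrite !big_setU1 ?big_set1 ?inE//= prodT.
rewrite !big_ord_recl !big_ord0 E3 fgm_args0 !fgm_args_lift.
ring.
Qed.

End FGM.

(** * Marginal laws as limits of the joint cdf *)

Section Marginals.
Context {d : measure_display} {T : measurableType d} {R : realType}.
Variables (P : probability T R) (N : T -> nat) (X : nat -> {RV P >-> R}).
Hypothesis mN : measurable_fun setT N.

Lemma measurable_forall_le k (f : 'I_k -> nat) (J : pred 'I_k) (x : 'I_k -> R) :
  measurable [set t | forall i, J i -> X (f i) t <= x i].
Proof.
rewrite (_ : [set t | _] =
   \bigcap_(i in [set i | J i]) [set t | X (f i) t <= x i]); last first.
  by apply/seteqP; split => t /= h i; apply: h.
apply: fin_bigcap_measurable => // i _.
by apply: measurable_boolset; apply: measurable_fun_ler => //; exact: measurable_cst.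
Qed.

Lemma measurable_leN (r : R) : measurable [set t | (N t)%:R <= r].
Proof.
exact: (measurable_boolset (measurable_fun_nat (fun n => n%:R <= r) mN)).
Qed.

(* The coordinates outside J are sent to infinity. *)
Lemma jcdf_marginal k (f : 'I_k -> nat) (J : pred 'I_k) r (x : 'I_k -> R) :
  jcdf P N X f r (fun i => if J i then x i else m%:R) @[m --> \oo] -->
  fine (P [set t | (N t)%:R <= r /\ forall i, J i -> X (f i) t <= x i]).
Proof.
pose F (m : nat) := [set t | (N t)%:R <= r] `&`
  [set t | forall i, xpredT i -> X (f i) t <= if J i then x i else m%:R].
have mF m : measurable (F m).
  by apply: measurableI; [exact: measurable_leN|exact: measurable_forall_le].
have FE : \bigcup_m F m =
    [set t | (N t)%:R <= r /\ forall i, J i -> X (f i) t <= x i].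
  apply/seteqP; split => t.
    by move=> [m _ [/= Nt h]]; split => // i Ji; move: (h i isT); rewrite Ji.
  (* The finitely many coordinates at [t] share an integer bound, so [t] enters the increasing union
     from that index on. *)
  move=> /= [Nt h]; exists (\max_i (Num.truncn (X (f i) t)).+1)%N => //.
  split => // i _; case: ifPn => Ji; first exact: h.
  rewrite (le_trans (ltW (truncnS_gt _)))// ler_nat.
  exact: (leq_bigmax (F := fun i => (Num.truncn (X (f i) t)).+1)).
rewrite -FE; apply: fine_cvg; rewrite fineK ?fin_num_measure//; last first.
  exact: bigcupT_measurable.
have := @nondecreasing_cvg_mu _ _ _ P F mF (bigcupT_measurable _ mF).
rewrite (_ : P \o F = (fun m => P [set t | (N t)%:R <= r /\
   forall i, X (f i) t <= if J i then x i else m%:R])); last first.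
  apply/funext => m /=; congr (P _); apply/seteqP.
  by split => t /= [Nt h]; split => // i *; exact: h.
apply => m n mn; apply/subsetPset => t [Nt h]; split => // i _.
by have := h i isT; case: ifP => // _ /le_trans -> //; rewrite ler_nat.
Qed.

Lemma cdfR_cvg j : cdfR P (X j) m%:R @[m --> \oo] --> (1 : R).
Proof.
pose F (m : nat) := [set t | X j t <= m%:R].
have mF m : measurable (F m).
  by apply: measurable_boolset; apply: measurable_fun_ler => //; exact: measurable_cst.
have FE : \bigcup_m F m = setT.
  apply/seteqP; split => // t _; exists (Num.truncn (X j t)).+1 => //=.
  exact/ltW/truncnS_gt.
apply: fine_cvg; rewrite -(@probability_setT _ _ _ P) -FE.
apply: nondecreasing_cvg_mu => //; first exact: bigcupT_measurable.
move=> m n mn; apply/subsetPset => t /= /le_trans; apply; rewrite ler_nat//.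
Qed.

End Marginals.

(** * Joint laws of N with one claim and with two claims *)

Section Laws.
Context {d : measure_display} {T : measurableType d} {R : realType}.
Variables (P : probability T R) (N : T -> nat) (X : nat -> {RV P >-> R}).
Variable th : forall k : nat, {set 'I_k.+1} -> R.
Hypothesis mN : measurable_fun setT N.
Hypothesis same_cdf :
  forall j x, (1 <= j)%N -> cdfR P (X j) x = cdfR P (X 1%N) x.
Local Notation reached k := (exists n : nat, (k <= n)%N /\ 0 < pmfN P N n).
Hypothesis fgm : forall k, (1 <= k)%N -> reached k ->
  forall (r : R) (x : 'I_k -> R),
    jcdf P N X (fun i : 'I_k => (i : nat).+1) r x =
    fgm_copula (@th k) (fgm_args (cdfN P N r) (fun i => cdfR P (X 1%N) (x i))).
Hypothesis exch : forall k, (1 <= k)%N -> reached k ->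
  forall (s : {perm 'I_k}) (r : R) (x : 'I_k -> R),
    jcdf P N X (fun i : 'I_k => (s i : nat).+1) r x =
    jcdf P N X (fun i : 'I_k => (i : nat).+1) r x.

Let F (x : R) : R := cdfR P (X 1%N) x.
Let G (r : R) : R := cdfN P N r.
Let th01 := @th 1%N [set ord0; ord_max]%SET.
Let th12 := @th 2%N [set inord 1; inord 2]%SET.
Let th012 := @th 2%N [set: 'I_3]%SET.

(** Exchangeability is given for full tuples of thresholds only; the two marginals are limits of one
    and the same sequence of joint cdfs. *)
Lemma exch_marginal k (s : {perm 'I_k}) (J : pred 'I_k) (r : R) (x : 'I_k -> R) :
  (1 <= k)%N -> reached k ->
  fine (P [set t | (N t)%:R <= r /\ forall i, J i -> X (s i : nat).+1 t <= x i])
  = fine (P [set t | (N t)%:R <= r /\ forall i : 'I_k, J i -> X i.+1 t <= x i]).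
Proof.
move=> k1 rk.
have h1 := @jcdf_marginal _ _ _ P N X mN k (fun i => (s i : nat).+1) J r x.
have h2 := @jcdf_marginal _ _ _ P N X mN k (fun i : 'I_k => i.+1) J r x.
have e : (fun m : nat => jcdf P N X (fun i : 'I_k => (s i : nat).+1) r
            (fun i => if J i then x i else m%:R : R)) =
         (fun m : nat => jcdf P N X (fun i : 'I_k => i.+1) r
            (fun i => if J i then x i else m%:R : R)).
  by apply/funext => m; exact: exch.
by rewrite e in h1; exact: (cvg_unique _ h1 h2).
Qed.

(** Within the tuple of length [i], which [reached i] makes available, the transposition of the
    first and last places brings X_i to place 1, where C_1 applies. *)
Lemma joint_law1 i (r x : R) : (1 <= i)%N -> reached i ->
  prob P (fun t => ((N t)%:R <= r) && (X i t <= x)) =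
  G r * F x * (1 + th01 * (1 - G r) * (1 - F x)).
Proof.
case: i => // i _ ri.
have r1 : reached 1%N by case: ri => n [in_ n0]; exists n; split=> //; lia.
have := @exch_marginal i.+1 (tperm ord0 ord_max) (pred1 ord0) r (fun=> x) isT ri.
have -> : [set t | (N t)%:R <= r /\ forall k : 'I_i.+1, pred1 ord0 k ->
    X (tperm ord0 ord_max k : 'I_i.+1).+1 t <= x] =
    [set t | ((N t)%:R <= r) && (X i.+1 t <= x)].
  apply/seteqP; split => t /=.
    by move=> [-> /(_ ord0 (eqxx _))]; rewrite tpermL.
  by move=> /andP[-> h]; split => // k /eqP ->; rewrite tpermL.
rewrite -/(prob _ _) => ->.
rewrite /th01 -(fgm_copula2 (@th 1%N) (G r) (fun=> F x)) -(@fgm 1%N)//.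
rewrite /jcdf; congr (fine (P _)); apply/seteqP; split => t /= [-> h]; split => //.
  by move=> k; rewrite (ord1 k); exact: (h ord0).
by move=> k /eqP ->; exact: (h ord0).
Qed.

(* The parameters of C_2 at {0,1} and {0,2} need not equal theta_01 when a
   marginal is degenerate; only these products agree. *)
Lemma fgm3_marginal01 r x : reached 2%N ->
  @th 2%N [set inord 0; inord 1]%SET * (G r * (1 - G r)) * (F x * (1 - F x)) =
  th01 * (G r * (1 - G r)) * (F x * (1 - F x)).
Proof.
move=> r2.
have r1 : reached 1%N by case: r2 => n [in_ n0]; exists n; split=> //; lia.
have := @jcdf_marginal _ _ _ P N X mN 2%N (fun i : 'I_2 => i.+1) (pred1 ord0) r (fun=> x).
have -> : [set t | (N t)%:R <= r /\ forall k : 'I_2, pred1 ord0 k ->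
    X k.+1 t <= x] = [set t | ((N t)%:R <= r) && (X 1%N t <= x)].
  apply/seteqP; split => t /=; first by move=> [-> /(_ ord0 (eqxx _))].
  by move=> /andP[-> h]; split => // k /eqP ->.
rewrite -/(prob _ _) joint_law1// => h1.
(* C_2 is rearranged so that [m] enters only through [F m%:R], which tends to 1: every term
   involving the discarded claim carries the factor [1 - F m%:R] and dies in the limit. *)
have h2 : (fun m : nat => jcdf P N X (fun i : 'I_2 => i.+1) r
    (fun i => if pred1 ord0 i then x else m%:R : R)) =
    (fun m : nat => F m%:R * (G r * F x * (1 +
      @th 2%N [set inord 0; inord 1]%SET * (1 - G r) * (1 - F x))
    + (1 - F m%:R) * (G r * F x * (@th 2%N [set inord 0; inord 2]%SET * (1 - G r)
      + th12 * (1 - F x) + th012 * (1 - G r) * (1 - F x))))).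
  apply/funext => m; rewrite fgm// fgm_copula3 /= -/(F _) -/(F _) -/(G _).
  by rewrite /th12 /th012; ring.
rewrite h2 in h1.
have Fc := @cdfR_cvg _ _ _ P X 1%N.
have h3 : (fun m : nat => F m%:R * (G r * F x * (1 +
      @th 2%N [set inord 0; inord 1]%SET * (1 - G r) * (1 - F x))
    + (1 - F m%:R) * (G r * F x * (@th 2%N [set inord 0; inord 2]%SET * (1 - G r)
      + th12 * (1 - F x) + th012 * (1 - G r) * (1 - F x))))) @ \oo -->
   1 * (G r * F x * (1 + @th 2%N [set inord 0; inord 1]%SET * (1 - G r) * (1 - F x))
    + (1 - 1) * (G r * F x * (@th 2%N [set inord 0; inord 2]%SET * (1 - G r)
      + th12 * (1 - F x) + th012 * (1 - G r) * (1 - F x)))).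
  apply: cvgM => //; apply: cvgD; first exact: cvg_cst.
  by apply: cvgMl; apply: cvgB => //; exact: cvg_cst.
have e := cvg_unique (@Rhausdorff R) h1 h3.
transitivity (1 * (G r * F x * (1 + @th 2%N [set inord 0; inord 1]%SET * (1 - G r) * (1 - F x))
    + (1 - 1) * (G r * F x * (@th 2%N [set inord 0; inord 2]%SET * (1 - G r)
      + th12 * (1 - F x) + th012 * (1 - G r) * (1 - F x)))) - G r * F x); first by ring.
by rewrite -e; ring.
Qed.

(** The law of (N, X_2) is known from [joint_law1], so this is where exchangeability forces the
    coordinate pairs {0,1} and {0,2} to agree up to the degenerate factors. *)
Lemma fgm3_marginal02 r x : reached 2%N ->
  @th 2%N [set inord 0; inord 2]%SET * (G r * (1 - G r)) * (F x * (1 - F x)) =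
  th01 * (G r * (1 - G r)) * (F x * (1 - F x)).
Proof.
move=> r2.
have r1 : reached 1%N by case: r2 => n [in_ n0]; exists n; split=> //; lia.
have := @jcdf_marginal _ _ _ P N X mN 2%N (fun i : 'I_2 => i.+1) (pred1 ord_max) r (fun=> x).
have -> : [set t | (N t)%:R <= r /\ forall k : 'I_2, pred1 ord_max k ->
    X k.+1 t <= x] = [set t | ((N t)%:R <= r) && (X 2%N t <= x)].
  apply/seteqP; split => t /=; first by move=> [-> /(_ ord_max (eqxx _))].
  by move=> /andP[-> h]; split => // k /eqP ->.
rewrite -/(prob _ _) joint_law1// => h1.
have h2 : (fun m : nat => jcdf P N X (fun i : 'I_2 => i.+1) r
    (fun i => if pred1 ord_max i then x else m%:R : R)) =
    (fun m : nat => F m%:R * (G r * F x * (1 +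
      @th 2%N [set inord 0; inord 2]%SET * (1 - G r) * (1 - F x))
    + (1 - F m%:R) * (G r * F x * (@th 2%N [set inord 0; inord 1]%SET * (1 - G r)
      + th12 * (1 - F x) + th012 * (1 - G r) * (1 - F x))))).
  apply/funext => m; rewrite fgm// fgm_copula3 /= -/(F _) -/(F _) -/(G _).
  by rewrite /th12 /th012; ring.
rewrite h2 in h1.
have Fc := @cdfR_cvg _ _ _ P X 1%N.
have h3 : (fun m : nat => F m%:R * (G r * F x * (1 +
      @th 2%N [set inord 0; inord 2]%SET * (1 - G r) * (1 - F x))
    + (1 - F m%:R) * (G r * F x * (@th 2%N [set inord 0; inord 1]%SET * (1 - G r)
      + th12 * (1 - F x) + th012 * (1 - G r) * (1 - F x))))) @ \oo -->
   1 * (G r * F x * (1 + @th 2%N [set inord 0; inord 2]%SET * (1 - G r) * (1 - F x))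
    + (1 - 1) * (G r * F x * (@th 2%N [set inord 0; inord 1]%SET * (1 - G r)
      + th12 * (1 - F x) + th012 * (1 - G r) * (1 - F x)))).
  apply: cvgM => //; apply: cvgD; first exact: cvg_cst.
  by apply: cvgMl; apply: cvgB => //; exact: cvg_cst.
have e := cvg_unique (@Rhausdorff R) h1 h3.
transitivity (1 * (G r * F x * (1 + @th 2%N [set inord 0; inord 2]%SET * (1 - G r) * (1 - F x))
    + (1 - 1) * (G r * F x * (@th 2%N [set inord 0; inord 1]%SET * (1 - G r)
      + th12 * (1 - F x) + th012 * (1 - G r) * (1 - F x)))) - G r * F x); first by ring.
by rewrite -e; ring.
Qed.

(** The form with G (1 - G) and F (1 - F) kept whole serves twice: these products allow the [th01]
    of C_1 to replace the two parameters of C_2, and the jump of G (1 - G) in N is known. *)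
Lemma joint_law2 i j (r x y : R) : (1 <= i)%N -> (1 <= j)%N -> i != j ->
  reached i -> reached j ->
  prob P (fun t => ((N t)%:R <= r) && ((X i t <= x) && (X j t <= y))) =
  G r * F x * F y + th01 * (G r * (1 - G r)) * (F x * (1 - F x)) * F y
  + th01 * (G r * (1 - G r)) * F x * (F y * (1 - F y))
  + th12 * G r * (F x * (1 - F x)) * (F y * (1 - F y))
  + th012 * (G r * (1 - G r)) * (F x * (1 - F x)) * (F y * (1 - F y)).
Proof.
case: i j => [//|i] [//|j] _ _ ij ri rj.
(* After the shift the claims are numbered [i.+1] and [j.+1], and [m.+2] is the larger of the two
   numbers since [i != j] excludes a maximum of 0. *)
pose m := (maxn i j).-1.
have [im jm] : (i < m.+2)%N /\ (j < m.+2)%N by rewrite /m; lia.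
have rm : reached m.+2.
  by case: ri => ni [? ?]; case: rj => nj [? ?];
     rewrite /m; case: (leqP i j) => ?; [exists nj|exists ni]; split => //; lia.
have r2 : reached 2%N by case: rm => n [? ?]; exists n; split => //; lia.
pose o1 : 'I_m.+2 := lift ord0 ord0.
pose a : 'I_m.+2 := inord i; pose b : 'I_m.+2 := inord j.
have ab : a != b by rewrite -val_eqE /= !inordK.
(* A permutation with 0 -> [a] and 1 -> [b] is needed. The swap of 0 and [a] settles the first; [c]
   is the place it sends to [b], so swapping 1 with [c] beforehand settles the second. As [c] is not
   0, the first requirement survives. *)
pose c := tperm ord0 a b.
have c0 : c != ord0.
  by rewrite /c -[X in _ != X](tpermR ord0 a) (inj_eq perm_inj) eq_sym.
pose s := (tperm o1 c * tperm ord0 a)%g.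
have s0 : s ord0 = a by rewrite permM (@tpermD _ o1 c ord0)// tpermL.
have s1 : s o1 = b by rewrite permM (tpermL o1 c) /c tpermK.
pose J := [pred k : 'I_m.+2 | (k == ord0) || (k == o1)].
pose xy (k : 'I_m.+2) := if k == ord0 then x else y.
have := @exch_marginal m.+2 s J r xy isT rm.
have -> : [set t | (N t)%:R <= r /\ forall k : 'I_m.+2, J k ->
    X (s k : nat).+1 t <= xy k] =
    [set t | ((N t)%:R <= r) && ((X i.+1 t <= x) && (X j.+1 t <= y))].
  apply/seteqP; split => t /=.
    move=> [-> h]; have := h ord0 isT; have := h o1 isT.
    by rewrite s0 s1 /xy /= !inordK// => -> ->.
  move=> /and3P[-> hx hy]; split => // k /orP[] /eqP ->.
    by rewrite s0 /xy /= inordK.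
  by rewrite s1 /xy /= inordK.
rewrite -/(prob _ _) => ->.
pose xy2 (k : 'I_2) := if k == ord0 then x else y.
transitivity (jcdf P N X (fun k : 'I_2 => (k : nat).+1) r xy2).
  rewrite /jcdf; congr (fine (P _)); apply/seteqP; split => t /= [-> h]; split => //.
    move=> [[|[|k]] Hk]; rewrite /xy2 //=; first exact: (h ord0 isT).
    exact: (h o1 isT).
  move=> k /orP[] /eqP -> /=; first exact: (h ord0).
  exact: (h ord_max).
rewrite fgm// fgm_copula3 /= -/(F x) -/(F y) -/(G r).
have e1 := fgm3_marginal01 r x r2; have e2 := fgm3_marginal02 r y r2.
rewrite -/th12 -/th012 in e1 e2 *.
have -> : th01 * (G r * (1 - G r)) * F x * (F y * (1 - F y)) =
   th01 * (G r * (1 - G r)) * (F y * (1 - F y)) * F x by ring.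
by rewrite -e1 -e2; ring.
Qed.

Let cur n : R := cdfN P N n%:R.
Let prv n : R := cdfN P N (n%:R - 1).
Let gam n : R := pmfN P N n.
Let del n : R := pmfNmax P N n - pmfNmin P N n.

Lemma cdfN_product_jump n :
  cur n * (1 - cur n) - prv n * (1 - prv n) = - del n / 2.
Proof.
by rewrite /del pmfNmaxE// pmfNminE// pmfN_cdfN// -/(cur n) -/(prv n); field.
Qed.

Lemma prob_joint_cdf n c : measurable_fun setT c ->
  prob P (fun t => (N t == n) && c t) =
  prob P (fun t => ((N t)%:R <= n%:R :> R) && c t)
  - prob P (fun t => ((N t)%:R <= n%:R - 1 :> R) && c t).
Proof.
move=> mc; rewrite prob_eqn_and//; congr (_ - _); apply: eq_prob => t.
  by rewrite ler_nat.
by rewrite lerBrDr natr1 ler_nat.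
Qed.

Lemma measurable_Xle i (x : R) : measurable_fun setT (fun t => X i t <= x).
Proof. by apply: measurable_fun_ler => //; exact: measurable_cst. Qed.

(** Complementing in the claim changes the sign of the F (1 - F) term, and the jump of G (1 - G)
    brings a second minus sign, hence the plus. The bound [i <= n] with positive mass at [n] makes
    the copula hypothesis available. *)
Lemma tail1 i n a : (1 <= i <= n)%N -> 0 < gam n ->
  prob P (fun t => (N t == n) && (a < X i t)) =
  gam n * (1 - F a) + th01 / 2 * del n * (F a * (1 - F a)).
Proof.
move=> /andP[i1 iN] n0; have ri : reached i by exists n.
have mn : measurable_fun setT (fun t => N t == n).
  exact: (measurable_fun_nat (fun k => k == n)).
have := prob_split P mn (measurable_Xle i a).
rewrite -pmfN_prob prob_joint_cdf ?joint_law1//; last exact: measurable_Xle.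
rewrite -/(gam n) -/(cur n) -/(prv n) (@eq_prob _ _ _ _ (fun t => _ && ~~ _)
  (fun t => (N t == n) && (a < X i t))); last by move=> t; rewrite ltNge.
have := cdfN_product_jump n.
have : gam n = cur n - prv n by exact: pmfN_cdfN.
rewrite /G -/(cur n) -/(prv n).
move: (prob P _) (del n) => p D; move: (cur n) (prv n) (F a) => u v f -> h e.
have -> : D = -2 * (u * (1 - u) - v * (1 - v)) by rewrite h; field.
have -> : p = u - v - (u * f * (1 + th01 * (1 - u) * (1 - f))
   - v * f * (1 + th01 * (1 - v) * (1 - f))) by rewrite {1}e; ring.
by field.
Qed.

(** Two successive splittings, on X_j and then on X_i, reduce the upper orthant to [tail1] and lower
    orthants. Terms with both factors F (1 - F) change sign twice, so only the jump of G (1 - G)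
    leaves a minus, in front of [th012]. *)
Lemma tail2 i j n a b : (1 <= i <= n)%N -> (1 <= j <= n)%N -> i != j ->
  0 < gam n ->
  prob P (fun t => (N t == n) && ((a < X i t) && (b < X j t))) =
  gam n * ((1 - F a) * (1 - F b))
  + th01 / 2 * del n * (F a * (1 - F a)) * (1 - F b)
  + th01 / 2 * del n * (1 - F a) * (F b * (1 - F b))
  + th12 * gam n * (F a * (1 - F a)) * (F b * (1 - F b))
  - th012 / 2 * del n * (F a * (1 - F a)) * (F b * (1 - F b)).
Proof.
move=> /andP[i1 iN] /andP[j1 jN] ij n0.
have ri : reached i by exists n.
have rj : reached j by exists n.
have mn : measurable_fun setT (fun t => N t == n).
  exact: (measurable_fun_nat (fun k => k == n)).
have mi := measurable_Xle i a; have mj := measurable_Xle j b.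
have mgi : measurable_fun setT (fun t => a < X i t).
  by apply: measurable_fun_ltr => //; exact: measurable_cst.
have h1 := prob_split P (measurable_and mn mgi) mj.
rewrite (@eq_prob _ _ _ _ (fun t => _ && ~~ (X j t <= b))
  (fun t => (N t == n) && ((a < X i t) && (b < X j t)))) in h1; last first.
  by move=> t; rewrite -ltNge andbA.
have h2 := prob_split P (measurable_and mn mj) mi.
rewrite (@eq_prob _ _ _ _ (fun t => _ && ~~ (X i t <= a))
  (fun t => (N t == n) && (a < X i t) && (X j t <= b))) in h2; last first.
  by move=> t; rewrite -ltNge -!andbA; congr (_ && _); rewrite andbC.
rewrite (@eq_prob _ _ _ _ (fun t => _ && _ && (X i t <= a))
  (fun t => (N t == n) && ((X i t <= a) && (X j t <= b)))) in h2; last first.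
  by move=> t; rewrite -!andbA; congr (_ && _); rewrite andbC.
rewrite (prob_joint_cdf _ mj) (prob_joint_cdf _ (measurable_and mi mj)) in h2.
rewrite !joint_law1// !joint_law2// in h2.
rewrite tail1 ?i1// in h1.
have := cdfN_product_jump n.
have : gam n = cur n - prv n by exact: pmfN_cdfN.
rewrite /G -/(cur n) -/(prv n) in h2.
move: h1 h2.
move: (prob P (fun t => (N t == n) && ((a < X i t) && (b < X j t)))) => p.
move: (prob P _) (del n) => q D; move: (cur n) (prv n) (F a) (F b) => u v f g h1 h2 e h.
have ED : D = -2 * (u * (1 - u) - v * (1 - v)) by rewrite h; field.
have Ep : p = gam n * (1 - f) + th01 / 2 * D * (f * (1 - f)) - q by rewrite h1; ring.
have Eq := canRL (addKr _) (esym h2); rewrite Ep Eq ED e; by field.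
Qed.

End Laws.

(** * Moments on the level sets of N *)

Section SameLaw.
Context {d : measure_display} {T : measurableType d} {R : realType}.
Variable P : probability T R.

(** Open upper rays form a generating pi-system of sets whose mass the cdf determines, and the rays
    from -n cover the line. *)
Lemma same_cdf_distribution (Y Z : {RV P >-> R}) (A : set R) :
  (forall x, cdfR P Y x = cdfR P Z x) -> measurable A ->
  distribution P Y A = distribution P Z A.
Proof.
move=> YZ; apply: (measure_unique (@RGenOInfty.G R) (fun n => `]- n%:R, +oo[%classic)).
- exact: RGenOInfty.measurableE.
- move=> _ _ [x ->] [y ->]; exists (Num.max x y).
  by apply/seteqP; split => z /=; rewrite !in_itv/= !andbT gt_max => /andP.
- by move=> n; exists (- n%:R).
- apply/seteqP; split => // x _; exists (Num.truncn (- x)).+1 => //=.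
  by rewrite in_itv/= andbT ltrNl; exact: truncnS_gt.
- move=> _ [x ->]; rewrite /distribution /pushforward.
  have h (U : {RV P >-> R}) :
      (P (U @^-1` `]x, +oo[) = (1 - cdfR P U x)%:E)%E.
    rewrite -prob_tail// /prob fineK ?fin_num_measure//; last first.
      apply: measurable_boolset; apply: measurable_fun_ltr => //.
    by congr (P _); apply/seteqP; split => t /=; rewrite in_itv/= andbT.
  by have := h Y; have := h Z; rewrite YZ => hZ hY; exact: etrans hY (esym hZ).
- move=> n; rewrite (le_lt_trans (probability_le1 _ _))// ?ltry//.
Qed.

(** Square integrability is assumed for X_1 and must be transported to the other claims, of which
    only the cdf is known to agree. *)
Lemma same_cdf_sqr_intg (Y Z : {RV P >-> R}) :
  (forall x, cdfR P Y x = cdfR P Z x) ->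
  intg P (fun t => Y t ^+ 2) -> intg P (fun t => Z t ^+ 2).
Proof.
move=> YZ /integrableP[mY Yoo]; apply/integrableP; split.
  by apply/measurable_EFinP; exact: measurable_funX.
have mf : measurable_fun [set: R] (fun x : R => `|(x ^+ 2)%:E|%E).
  by apply: measurableT_comp => //; apply/measurable_EFinP; exact: measurable_funX.
have f0 (x : R) : (0 <= `|(x ^+ 2)%:E|)%E by [].
apply: le_lt_trans Yoo.
rewrite -(ge0_integral_distribution Y mf f0) -(ge0_integral_distribution Z mf f0).
rewrite le_eqVlt; apply/orP; left; apply/eqP.
by apply: eq_measure_integral => A mA _; apply/esym; exact: same_cdf_distribution.
Qed.

End SameLaw.

(** * Moments of a variable and of its iid extremes as limits of tail sums *)

Section TailIntegrals.
Context {d : measure_display} {T : measurableType d} {R : realType}.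
Variables (P : probability T R) (Y : T -> R).
Hypothesis mY : measurable_fun setT Y.
Hypothesis Y0 : {ae P, forall t, 0 <= Y t}.
Hypothesis IY : intg P (fun t => Y t ^+ 2).
Let F (x : R) : R := cdfR P Y x.
Let PP : probability (T * T)%type R := (P \x P)%E.

(** The probability space is free, so that the result applies to [Y] under [P] and to its extremes
    under the product measure. *)
Lemma mean_tail (d' : measure_display) (T' : measurableType d')
    (Q : probability T' R) (Z : T' -> R) (H : R -> R) :
  intg Q Z -> {ae Q, forall t, 0 <= Z t} ->
  (forall a, prob Q (fun t => a < Z t) = H a) ->
  sum1 m H @[m --> \oo] --> mean Q Z.
Proof.
move=> IZ Z0 ZH; have := mean_tail_cvg (measurable_cst true) IZ Z0.
under eq_fun do under eq_fun do rewrite /= ZH.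
by rewrite (_ : (fun t => _) = Z)//; apply/funext => t; rewrite /= mulr1.
Qed.

(** The square is treated as a product of two equal variables: exceeding both [a] and [b] means
    exceeding their maximum. *)
Lemma mom2_tail (d' : measure_display) (T' : measurableType d')
    (Q : probability T' R) (Z : T' -> R) (H : R -> R) :
  measurable_fun setT Z ->
  intg Q (fun t => Z t ^+ 2) -> {ae Q, forall t, 0 <= Z t} ->
  (forall a, prob Q (fun t => a < Z t) = H a) ->
  sum2 m (fun a b => H (Num.max a b)) @[m --> \oo] --> mom2 Q Z.
Proof.
move=> mZ IZ Z0 ZH.
have := mean_tail2_cvg (measurable_cst true) mZ mZ IZ Z0 Z0.
rewrite (_ : (fun a b => _) = (fun a b => H (Num.max a b))); last first.
  apply/funext => a; apply/funext => b; rewrite -ZH.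
  by apply: eq_prob => t /=; rewrite gt_max.
by rewrite (_ : (fun t => _) = (fun t => Z t ^+ 2))//; apply/funext => t /=; rewrite mulr1.
Qed.

Let IY1 : intg P Y := intg_sqrW mY IY.

Lemma ordmax_ae_ge0 : {ae PP, forall z, 0 <= ordmax Y z}.
Proof.
by apply: filterS (ae_prod_ge0 mY Y0) => z [z1 z2]; rewrite /ordmax le_max z1.
Qed.

Lemma ordmin_ae_ge0 : {ae PP, forall z, 0 <= ordmin Y z}.
Proof.
by apply: filterS (ae_prod_ge0 mY Y0) => z [z1 z2]; rewrite /ordmin le_min z1.
Qed.

Lemma tail_mean : sum1 m (fun a => 1 - F a) @[m --> \oo] --> mean P Y.
Proof. by apply: mean_tail => // a; rewrite prob_tail. Qed.

Lemma tail_spread : sum1 m (fun a => 2 * (F a * (1 - F a))) @[m --> \oo] -->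
  mean PP (ordmax Y) - mean PP (ordmin Y).
Proof.
rewrite (_ : (fun m => _) = (fun m => sum1 m (fun a => 1 - F a ^+ 2)
    - sum1 m (fun a => (1 - F a) ^+ 2))).
  apply: cvgB; apply: mean_tail.
  - exact: intg_ordmax.
  - exact: ordmax_ae_ge0.
  - by move=> a; rewrite prob_tail_max.
  - exact: intg_ordmin.
  - exact: ordmin_ae_ge0.
  - by move=> a; rewrite prob_tail_min.
apply/funext => m; rewrite -mulN1r -sum1Z -sum1D; congr sum1.
by apply/funext => a; ring.
Qed.

(** Maximum plus minimum is the sum of the two copies; on tails, (1 - F^2) + (1 - F)^2 = 2 (1 - F).
    It later turns 2 E[X] D into the difference of the squared means of the extremes. *)
Lemma mean_ordmaxDmin :
  mean PP (ordmax Y) + mean PP (ordmin Y) = 2 * mean P Y.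
Proof.
have h : sum1 m (fun a => 2 * (1 - F a)) @[m --> \oo] -->
    mean PP (ordmax Y) + mean PP (ordmin Y).
  rewrite (_ : (fun m => _) = (fun m => sum1 m (fun a => 1 - F a ^+ 2)
      + sum1 m (fun a => (1 - F a) ^+ 2))).
    apply: cvgD; apply: mean_tail.
    - exact: intg_ordmax.
    - exact: ordmax_ae_ge0.
    - by move=> a; rewrite prob_tail_max.
    - exact: intg_ordmin.
    - exact: ordmin_ae_ge0.
    - by move=> a; rewrite prob_tail_min.
  apply/funext => m; rewrite -sum1D; congr sum1.
  by apply/funext => a; ring.
apply: (cvg_unique (@Rhausdorff R) h).
rewrite (_ : (fun m => _) = (fun m => 2 * sum1 m (fun a => 1 - F a))).
  by apply: cvgMr; exact: tail_mean.
by apply/funext => m; rewrite -sum1Z.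
Qed.

Lemma tail_mom2 :
  sum2 m (fun a b => 1 - F (Num.max a b)) @[m --> \oo] --> mom2 P Y.
Proof. by apply: (mom2_tail (H := fun a => 1 - F a)) => // a; rewrite prob_tail. Qed.

Lemma tail_spread2 :
  sum2 m (fun a b => 2 * (F (Num.max a b) * (1 - F (Num.max a b)))) @[m --> \oo]
  --> mom2 PP (ordmax Y) - mom2 PP (ordmin Y).
Proof.
rewrite (_ : (fun m => _) = (fun m => sum2 m (fun a b => 1 - F (Num.max a b) ^+ 2)
    - sum2 m (fun a b => (1 - F (Num.max a b)) ^+ 2))).
  apply: cvgB.
    apply: (mom2_tail (H := fun a => 1 - F a ^+ 2)).
    - exact: measurable_ordmax.
    - exact: intg_ordmax_sqr.
    - exact: ordmax_ae_ge0.
    - by move=> a; rewrite prob_tail_max.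
  apply: (mom2_tail (H := fun a => (1 - F a) ^+ 2)).
  - exact: measurable_ordmin.
  - exact: intg_ordmin_sqr.
  - exact: ordmin_ae_ge0.
  - by move=> a; rewrite prob_tail_min.
apply/funext => m; rewrite -mulN1r -sum2Z -sum2D; congr sum2.
by apply/funext => a; apply/funext => b; ring.
Qed.

End TailIntegrals.

(** * First, second and mixed moments of the claims on the event N = n *)

Section CondMoments.
Context {d : measure_display} {T : measurableType d} {R : realType}.
Variables (P : probability T R) (N : T -> nat) (X : nat -> {RV P >-> R}).
Variable th : forall k : nat, {set 'I_k.+1} -> R.
Hypothesis mN : measurable_fun setT N.
Hypothesis same_cdf :
  forall j x, (1 <= j)%N -> cdfR P (X j) x = cdfR P (X 1%N) x.
Hypothesis X0 : forall j, (1 <= j)%N -> P [set t | X j t <= 0] = 0%E.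
Hypothesis IX : intg P (fun t => X 1%N t ^+ 2).
Local Notation reached k := (exists n : nat, (k <= n)%N /\ 0 < pmfN P N n).
Hypothesis fgm : forall k, (1 <= k)%N -> reached k ->
  forall (r : R) (x : 'I_k -> R),
    jcdf P N X (fun i : 'I_k => (i : nat).+1) r x =
    fgm_copula (@th k) (fgm_args (cdfN P N r) (fun i => cdfR P (X 1%N) (x i))).
Hypothesis exch : forall k, (1 <= k)%N -> reached k ->
  forall (s : {perm 'I_k}) (r : R) (x : 'I_k -> R),
    jcdf P N X (fun i : 'I_k => (s i : nat).+1) r x =
    jcdf P N X (fun i : 'I_k => (i : nat).+1) r x.

Let F (x : R) : R := cdfR P (X 1%N) x.
Let th01 := @th 1%N [set ord0; ord_max]%SET.
Let th12 := @th 2%N [set inord 1; inord 2]%SET.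
Let th012 := @th 2%N [set: 'I_3]%SET.
Let gam n : R := pmfN P N n.
Let del n : R := pmfNmax P N n - pmfNmin P N n.
Let X1 : T -> R := X 1%N.
Let m1 := mean P X1.
Let m2 := mom2 P X1.
Let D1 := mean (P \x P)%E (ordmax X1) - mean (P \x P)%E (ordmin X1).
Let D2 := mom2 (P \x P)%E (ordmax X1) - mom2 (P \x P)%E (ordmin X1).

Lemma claim_ae_ge0 j : (1 <= j)%N -> {ae P, forall t, 0 <= X j t}.
Proof.
move=> j1; exists [set t | X j t <= 0]; split; [|exact: X0|].
  by apply: measurable_boolset; apply: measurable_fun_ler => //; exact: measurable_cst.
by move=> t /= /negP; rewrite -ltNge => /ltW.
Qed.

Lemma claim_sqr_intg j : (1 <= j)%N -> intg P (fun t => X j t ^+ 2).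
Proof.
by move=> j1; apply: (same_cdf_sqr_intg _ IX) => x; rewrite same_cdf.
Qed.

Lemma measurable_claim j : measurable_fun setT (X j). Proof. by []. Qed.

Lemma claim_intg j : (1 <= j)%N -> intg P (X j).
Proof. by move=> j1; apply: intg_sqrW => //; exact: claim_sqr_intg. Qed.

Let mn n : measurable_fun setT (fun t => N t == n).
Proof. exact: (measurable_fun_nat (fun k => k == n)). Qed.

Let c1 := tail_mean (measurable_claim 1%N) (claim_ae_ge0 (leqnn 1)) IX.
Let c2 := tail_spread (measurable_claim 1%N) (claim_ae_ge0 (leqnn 1)) IX.
Let c3 := tail_mom2 (measurable_claim 1%N) (claim_ae_ge0 (leqnn 1)) IX.
Let c4 := tail_spread2 (measurable_claim 1%N) (claim_ae_ge0 (leqnn 1)) IX.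

(** The 4 combines the 1/2 of [tail1], which comes from the jump in N, with the 2 that makes 2 F (1
    - F) the spread of the extremes. *)
Lemma moment1 i n : (1 <= i <= n)%N -> 0 < gam n ->
  mean P (fun t => X i t * (N t == n)%:R) = gam n * m1 + th01 / 4 * del n * D1.
Proof.
move=> /andP[i1 iN] n0.
have h := mean_tail_cvg (mn n) (claim_intg i1) (claim_ae_ge0 i1).
apply: (cvg_unique (@Rhausdorff R) h).
rewrite (_ : (fun m => _) = (fun m => gam n * sum1 m (fun a => 1 - F a)
   + th01 / 4 * del n * sum1 m (fun a => 2 * (F a * (1 - F a))))).
  by apply: cvgD; apply: cvgMr; [exact: c1|exact: c2].
apply/funext => m; rewrite -!sum1Z -sum1D; congr sum1; apply/funext => a.
by rewrite (tail1 mN fgm exch) ?i1 ?iN// -/(F a) -/th01 -/(gam n) -/(del n); field.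
Qed.

Lemma moment2 i n : (1 <= i <= n)%N -> 0 < gam n ->
  mean P (fun t => X i t ^+ 2 * (N t == n)%:R) =
  gam n * m2 + th01 / 4 * del n * D2.
Proof.
move=> /andP[i1 iN] n0.
have h := mean_tail2_cvg (mn n) (measurable_claim i) (measurable_claim i)
  (claim_sqr_intg i1) (claim_ae_ge0 i1) (claim_ae_ge0 i1).
apply: (cvg_unique (@Rhausdorff R) h).
rewrite (_ : (fun m => _) = (fun m =>
   gam n * sum2 m (fun a b => 1 - F (Num.max a b)) + th01 / 4 * del n *
   sum2 m (fun a b => 2 * (F (Num.max a b) * (1 - F (Num.max a b)))))).
  by apply: cvgD; apply: cvgMr; [exact: c3|exact: c4].
apply/funext => m; rewrite -!sum2Z -sum2D; congr sum2.
apply/funext => a; apply/funext => b.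
rewrite (@eq_prob _ _ _ _ _ (fun t => (N t == n) && (Num.max a b < X i t))).
  by rewrite (tail1 mN fgm exch) ?i1 ?iN// -/(F _) -/th01 -/(gam n) -/(del n); field.
by move=> t; rewrite gt_max.
Qed.

(** Each term of [tail2] is a product in [a] and [b], so its grid sum factors. Every F (1 - F) costs
    a factor 1/2, giving 1/4 for [th12] and, with the 1/2 of the jump in N, 1/8 for [th012]. The two
    symmetric [th01] terms merge. *)
Lemma moment11 i j n : (1 <= i <= n)%N -> (1 <= j <= n)%N -> i != j ->
  0 < gam n ->
  mean P (fun t => X i t * X j t * (N t == n)%:R) =
  gam n * m1 ^+ 2 + th01 / 2 * del n * (D1 * m1) + th12 / 4 * gam n * D1 ^+ 2
  - th012 / 8 * del n * D1 ^+ 2.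
Proof.
move=> /andP[i1 iN] /andP[j1 jN] ij n0.
have Iij : intg P (fun t => X i t * X j t).
  by apply: intg_mul => //; exact: claim_sqr_intg.
have h := mean_tail2_cvg (mn n) (measurable_claim i) (measurable_claim j)
  Iij (claim_ae_ge0 i1) (claim_ae_ge0 j1).
apply: (cvg_unique (@Rhausdorff R) h).
rewrite (_ : (fun m => _) = (fun m =>
   gam n * (sum1 m (fun a => 1 - F a) * sum1 m (fun a => 1 - F a))
   + th01 / 4 * del n * (sum1 m (fun a => 2 * (F a * (1 - F a))) * sum1 m (fun a => 1 - F a))
   + th01 / 4 * del n * (sum1 m (fun a => 1 - F a) * sum1 m (fun a => 2 * (F a * (1 - F a))))
   + (th12 / 4 * gam n - th012 / 8 * del n) * (sum1 m (fun a => 2 * (F a * (1 - F a)))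
    * sum1 m (fun a => 2 * (F a * (1 - F a)))))).
  rewrite (_ : gam n * m1 ^+ 2 + th01 / 2 * del n * (D1 * m1) + th12 / 4 * gam n *
      D1 ^+ 2 - th012 / 8 * del n * D1 ^+ 2 = gam n * (m1 * m1) + th01 / 4 * del n * (D1 * m1)
    + th01 / 4 * del n * (m1 * D1) + (th12 / 4 * gam n - th012 / 8 * del n) * (D1 * D1)).
    by apply: cvgD; [apply: cvgD; [apply: cvgD|]|]; apply: cvgMr; apply: cvgM;
       (exact: c1 || exact: c2).
  by field.
apply/funext => m; rewrite -!sum2M -!sum2Z -!sum2D; congr sum2.
apply/funext => a; apply/funext => b.
rewrite (tail2 mN fgm exch) ?i1 ?j1//.
by rewrite -/(F _) -/(F _) -/th01 -/th12 -/th012 -/(gam n) -/(del n); field.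
Qed.

End CondMoments.

(** * Total expectation over N *)

Section TotalExpectation.
Context {d : measure_display} {T : measurableType d} {R : realType}.
Variables (P : probability T R) (N : T -> nat).
Hypothesis mN : measurable_fun setT N.
Implicit Types (Y : T -> R) (f g : nat -> R).

Let mn n : measurable_fun setT (fun t => N t == n).
Proof. exact: (measurable_fun_nat (fun k => k == n)). Qed.

Let levels : \bigcup_n [set t | N t == n] = setT.
Proof. by apply/seteqP; split => // t _; exists (N t) => //=. Qed.

Let trivIset_levels : trivIset setT (fun n => [set t | N t == n]).
Proof. by apply/trivIsetP => i j _ _ ij; apply/seteqP; split => // t [/= /eqP Ni /eqP Nj]; move: ij; rewrite -Ni Nj eqxx. Qed.

Lemma integral_level Y n :
  (\int[P]_(t in [set t | N t == n]) (Y t)%:E =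
   \int[P]_t (Y t * (N t == n)%:R)%:E)%E.
Proof.
rewrite integral_mkcond; apply: eq_integral => t _.
rewrite patchE; case: (boolP (N t == n)) => e; first by rewrite mem_set//= mulr1.
by rewrite memNset ?mulr0//; exact/negP.
Qed.

Lemma mean_total Y : intg P Y ->
  ((mean P Y)%:E = \sum_(0 <= n <oo) (mean P (fun t => (Y t * (N t == n)%:R)%R))%:E)%E.
Proof.
move=> IY; rewrite -expectation_mean// unlock -levels integral_bigcup//; last 2 first.
- by move=> n; exact: measurable_boolset.
- by rewrite levels.
apply: eq_eseriesr => n _; rewrite integral_level -expectation_mean; last exact: intg_bool_mul.
by rewrite unlock.
Qed.

Lemma mean_level_null Y n : measurable_fun setT Y -> ~ 0 < pmfN P N n ->
  mean P (fun t => Y t * (N t == n)%:R) = 0.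
Proof.
move=> mY n0; have pn : P [set t | N t == n] = 0%E.
  have : prob P (fun t => N t == n) = 0.
    apply/eqP; rewrite eq_le prob_ge0 andbT leNgt -pmfN_prob; exact/negP.
  rewrite /prob => h; rewrite -[LHS]fineK ?h// fin_num_measure//.
  exact: measurable_boolset.
transitivity (mean P (fun=> 0)); last first.
  by rewrite -[fun=> 0]/(cst 0) /mean expectation_cst.
apply: mean_ae_eq => //.
  by apply: measurable_funM => //; exact: measurable_bool2R.
exists [set t | N t == n]; split => //; first exact: measurable_boolset.
move=> t /= h; apply: contrapT => /negP/negbTE e; apply: h.
by rewrite e mulr0.
Qed.

Lemma mean_level f n :
  mean P (fun t => f (N t) * (N t == n)%:R) = pmfN P N n * f n.
Proof.
rewrite (_ : (fun t => _) = (fun t => f n * (N t == n)%:R)); last first.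
  by apply/funext => t; case: eqP => [->//|]; rewrite !mulr0.
by rewrite meanZ ?mean_bool -?pmfN_prob 1?mulrC//; exact: intg_bool.
Qed.

Lemma mean_nat_series f : intg P (fun t => f (N t)) ->
  ((mean P (fun t => f (N t)))%:E =
   \sum_(0 <= n <oo) (pmfN P N n * f n)%:E)%E.
Proof.
by move=> If; rewrite mean_total//; apply: eq_eseriesr => n _; rewrite mean_level.
Qed.

(** A conditional mean need only be known on the support of N, because null levels contribute
    nothing to either side. *)
Lemma mean_tower Y f : intg P Y -> intg P (fun t => f (N t)) ->
  (forall n, 0 < pmfN P N n ->
     mean P (fun t => Y t * (N t == n)%:R) = pmfN P N n * f n) ->
  mean P Y = mean P (fun t => f (N t)).
Proof.
move=> IY If Yf; apply: EFin_inj; rewrite mean_total// mean_total//.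
apply: eq_eseriesr => n _; congr EFin; case: (pselect (0 < pmfN P N n)) => n0.
  by rewrite Yf// mean_level.
by rewrite (mean_level_null (intg_meas IY) n0) (mean_level_null (intg_meas If) n0).
Qed.

(** For nonnegative [Y] the level sums may be computed before integrability is known. This is how
    S^2 is shown to be integrable. *)
Lemma ge0_intg_tower Y f : measurable_fun setT Y -> (forall t, 0 <= Y t) ->
  (forall n, intg P (fun t => Y t * (N t == n)%:R)) ->
  intg P (fun t => f (N t)) ->
  (forall n, 0 < pmfN P N n ->
     mean P (fun t => Y t * (N t == n)%:R) = pmfN P N n * f n) ->
  intg P Y.
Proof.
move=> mY Y0 IYn If Yf.
have fn n : 0 <= mean P (fun t => Y t * (N t == n)%:R).
  by rewrite fine_ge0//; apply: expectation_ge0 => t; rewrite mulr_ge0.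
(* Off the support [f] may be negative, hence the absolute value; on the support it changes nothing,
   since [pmfN P N n * f n] is the mean of a nonnegative function. *)
have E : (\int[P]_t (Y t)%:E = (mean P (fun t => `|f (N t)|))%:E)%E.
  rewrite -levels ge0_integral_bigcup//=; last 3 first.
  - by move=> n; exact: measurable_boolset.
  - by rewrite levels; exact/measurable_EFinP.
  - by move=> t _; rewrite lee_fin.
  rewrite (@mean_nat_series (fun n => `|f n|)); last exact: integrable_norm.
  apply: eq_eseriesr => n _; rewrite integral_level.
  transitivity (mean P (fun t => Y t * (N t == n)%:R))%:E.
    by rewrite -expectation_mean; [rewrite unlock|exact: IYn].
  congr EFin; case: (pselect (0 < pmfN P N n)) => n0.
    rewrite Yf// -[in RHS](ger0_norm (ltW n0)) -normrM ger0_norm// -Yf//.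
  rewrite mean_level_null//; have /eqP -> : pmfN P N n == 0.
    rewrite eq_le leNgt (introN idP n0)/= pmfN_prob; exact: prob_ge0.
  by rewrite mul0r.
apply/integrableP; split; first exact/measurable_EFinP.
under eq_integral do rewrite /= ger0_norm//.
by rewrite E ltry.
Qed.

(** Almost sure equality suffices, without integrability, so conditional moments with a default
    value off the support can be replaced by their closed forms. *)
Lemma expectation_nat_eq f g : (forall n, 0 < pmfN P N n -> f n = g n) ->
  ('E_P[(fun t => f (N t))] = 'E_P[(fun t => g (N t))])%E.
Proof.
move=> fg; rewrite unlock; apply: ae_eq_integral => //.
- by apply/measurable_EFinP; exact: (measurable_fun_nat f).
- by apply/measurable_EFinP; exact: (measurable_fun_nat g).
have : P.-negligible (\bigcup_(n in [set n | ~ 0 < pmfN P N n]) [set t | N t == n]).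
  rewrite bigcup_mkcond; apply: negligible_bigcup => n.
  case: ifPn; rewrite ?inE/= => n0; last exact: negligible_set0.
  apply/negligibleP; first exact: measurable_boolset.
  have : prob P (fun t => N t == n) = 0.
    apply/eqP; rewrite eq_le prob_ge0 andbT leNgt -pmfN_prob; exact/negP.
  rewrite /prob => h; rewrite -[LHS]fineK ?h// fin_num_measure//.
  exact: measurable_boolset.
apply: negligibleS => t /= h; exists (N t) => //= n0; apply: h => _.
by rewrite fg.
Qed.

Lemma variance_nat_eq f g : (forall n, 0 < pmfN P N n -> f n = g n) ->
  ('V_P[(fun t => f (N t))] = 'V_P[(fun t => g (N t))])%E.
Proof.
move=> fg; rewrite /variance covariance.unlock (expectation_nat_eq fg).
set c := fine _.
apply: (@expectation_nat_eq (fun n => (f n - c) * (f n - c))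
   (fun n => (g n - c) * (g n - c))) => n n0; by rewrite fg.
Qed.

End TotalExpectation.

(** * The ratio R_n and the moments of the extremes of N *)

Section CountRatio.
Context {d : measure_display} {T : measurableType d} {R : realType}.
Variables (P : probability T R) (N : T -> nat).
Hypothesis mN : measurable_fun setT N.
Hypothesis IN1 : intg P (natRV N).
Hypothesis IN2 : intg P (fun t => natRV N t ^+ 2).
Let PP : probability (T * T)%type R := (P \x P)%E.

(* R_n of the paper; equal to 0 when P(N = n) = 0, since x / 0 = 0. *)
Definition ratio n : R := (pmfNmax P N n - pmfNmin P N n) / pmfN P N n.

Lemma pmfN_ge0 n : 0 <= pmfN P N n.
Proof. by rewrite pmfN_prob prob_ge0. Qed.

(** Valid off the support as well, since the pmfs of both extremes contain the factor
    [pmfN P N n]. *)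
Lemma pmfN_ratio n : pmfN P N n * ratio n = pmfNmax P N n - pmfNmin P N n.
Proof.
rewrite /ratio; have [e|n0] := eqVneq (pmfN P N n) 0; last by rewrite mulrC divfK.
by rewrite pmfNmaxE// pmfNminE// e !mul0r subr0.
Qed.

Lemma ratio_bound n : `|ratio n| <= 2.
Proof.
rewrite /ratio; have [e|n0] := eqVneq (pmfN P N n) 0.
  by rewrite e invr0 mulr0 normr0.
rewrite pmfNmaxE// pmfNminE// -mulrBr mulrC mulKf// cdfN_nat cdfN_pred.
have h1 := prob_ge0 P (fun t => N t <= n)%N.
have h2 := prob_ge0 P (fun t => N t < n)%N.
have h3 := prob_le1 P (measurable_fun_nat (fun k => k <= n)%N mN).
have h4 := prob_le1 P (measurable_fun_nat (fun k => k < n)%N mN).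
by rewrite ler_norml; apply/andP; split; lra.
Qed.

(** [1 + ratio n / 2] is the density of the law of the maximum with respect to the law of N; for the
    minimum the sign is reversed. *)
Lemma mean_ordmax_nat (f : nat -> R) :
  intg PP (fun z => f (maxn (N z.1) (N z.2))) ->
  intg P (fun t => f (N t) * (1 + ratio (N t) / 2)) ->
  mean PP (fun z => f (maxn (N z.1) (N z.2))) =
  mean P (fun t => f (N t) * (1 + ratio (N t) / 2)).
Proof.
move=> I1 I2; apply: EFin_inj.
have mM : measurable_fun setT (fun z : T * T => maxn (N z.1) (N z.2)).
  by apply: measurable_fun_maxn; [exact: measurable_fst_comp|exact: measurable_snd_comp].
rewrite (mean_nat_series mM I1).
rewrite (mean_nat_series (f := fun n => f n * (1 + ratio n / 2)) mN I2).
apply: eq_eseriesr => n _; congr EFin.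
have -> : pmfN PP (fun z => maxn (N z.1) (N z.2)) n = pmfNmax P N n by [].
transitivity (f n * (pmfN P N n + pmfN P N n * ratio n / 2)); last by field.
by rewrite pmfN_ratio pmfNmaxE// pmfNminE//; field.
Qed.

Lemma mean_ordmin_nat (f : nat -> R) :
  intg PP (fun z => f (minn (N z.1) (N z.2))) ->
  intg P (fun t => f (N t) * (1 - ratio (N t) / 2)) ->
  mean PP (fun z => f (minn (N z.1) (N z.2))) =
  mean P (fun t => f (N t) * (1 - ratio (N t) / 2)).
Proof.
move=> I1 I2; apply: EFin_inj.
have mM : measurable_fun setT (fun z : T * T => minn (N z.1) (N z.2)).
  rewrite (_ : (fun z => _) =
      fun z => (N z.1 + N z.2 - maxn (N z.1) (N z.2))%N); last first.
    by apply/funext => z; lia.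
  apply: measurable_fun_subn.
    by apply: measurable_fun_addn; [exact: measurable_fst_comp|exact: measurable_snd_comp].
  by apply: measurable_fun_maxn; [exact: measurable_fst_comp|exact: measurable_snd_comp].
rewrite (mean_nat_series mM I1).
rewrite (mean_nat_series (f := fun n => f n * (1 - ratio n / 2)) mN I2).
apply: eq_eseriesr => n _; congr EFin.
have -> : pmfN PP (fun z => minn (N z.1) (N z.2)) n = pmfNmin P N n by [].
transitivity (f n * (pmfN P N n - pmfN P N n * ratio n / 2)); last by field.
by rewrite pmfN_ratio pmfNmaxE// pmfNminE//; field.
Qed.

(** A common normal form for the functions of N that occur, so that integrability and the mean are
    established once, for arbitrary coefficients. *)
Definition moment_comb (a1 a2 b1 b2 c1 c2 : R) n : R :=
  a1 * n%:R + a2 * n%:R ^+ 2 + b1 * (n%:R * ratio n) + b2 * (n%:R ^+ 2 * ratio n)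
  + c1 * (n%:R * ratio n ^+ 2) + c2 * (n%:R ^+ 2 * ratio n ^+ 2).

Lemma intg_count_ratio k l : (0 < k <= 2)%N ->
  intg P (fun t => (N t)%:R ^+ k * ratio (N t) ^+ l).
Proof.
move=> k2; apply: (intg_le (g := fun t => 2 ^+ l * (natRV N t ^+ k))).
- exact: (measurable_fun_nat (fun n => n%:R ^+ k * ratio n ^+ l)).
- move=> t; rewrite normrM normrX normr_nat mulrC normrX /natRV.
  by rewrite ler_wpM2r ?exprn_ge0// lerXn2r ?nnegrE ?ratio_bound.
- by apply: intgZ; case: k k2 => [//|[|[|k]]] // _; rewrite ?expr1.
Qed.

Lemma intg_moment_comb a1 a2 b1 b2 c1 c2 :
  intg P (fun t => moment_comb a1 a2 b1 b2 c1 c2 (N t)).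
Proof.
rewrite /moment_comb; (repeat apply: intgD); apply: intgZ.
- exact: IN1.
- exact: IN2.
- exact: (@intg_count_ratio 1 1).
- exact: (@intg_count_ratio 2 1).
- exact: (@intg_count_ratio 1 2).
- exact: (@intg_count_ratio 2 2).
Qed.

Lemma mean_moment_comb a1 a2 b1 b2 c1 c2 :
  mean P (fun t => moment_comb a1 a2 b1 b2 c1 c2 (N t)) =
  a1 * mean P (natRV N) + a2 * mom2 P (natRV N)
  + b1 * mean P (fun t => (N t)%:R * ratio (N t))
  + b2 * mean P (fun t => (N t)%:R ^+ 2 * ratio (N t))
  + c1 * mean P (fun t => (N t)%:R * ratio (N t) ^+ 2)
  + c2 * mean P (fun t => (N t)%:R ^+ 2 * ratio (N t) ^+ 2).
Proof.
have I10 : intg P (fun t => (N t)%:R) by exact: IN1.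
have I20 : intg P (fun t => (N t)%:R ^+ 2) by exact: IN2.
have I11 : intg P (fun t => (N t)%:R * ratio (N t)) by exact: (@intg_count_ratio 1 1).
have I21 : intg P (fun t => (N t)%:R ^+ 2 * ratio (N t)) by exact: (@intg_count_ratio 2 1).
have I12 : intg P (fun t => (N t)%:R * ratio (N t) ^+ 2) by exact: (@intg_count_ratio 1 2).
have I22 : intg P (fun t => (N t)%:R ^+ 2 * ratio (N t) ^+ 2) by exact: (@intg_count_ratio 2 2).
have IZ (c : R) f : intg P f -> intg P (fun t => c * f t) by exact: intgZ.
rewrite /moment_comb !meanD; last first.
1-10: repeat first [apply: IZ; assumption|apply: intgD].
by rewrite !meanZ.
Qed.

Let natr_maxn (m n : nat) : Num.max m%:R n%:R = (maxn m n)%:R :> R.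
Proof.
by case: (leqP m n) => h; [rewrite max_r ?ler_nat|rewrite max_l ?ler_nat ?(ltnW h)].
Qed.

Let natr_minn (m n : nat) : Num.min m%:R n%:R = (minn m n)%:R :> R.
Proof.
by case: (leqP m n) => h; [rewrite min_l ?ler_nat|rewrite min_r ?ler_nat ?(ltnW h)].
Qed.

Lemma mean_ordmax_count : mean PP (ordmax (natRV N)) =
  mean P (natRV N) + mean P (fun t => (N t)%:R * ratio (N t)) / 2.
Proof.
have e : ordmax (natRV N) = (fun z => (maxn (N z.1) (N z.2))%:R) :> (T * T -> R).
  by apply/funext => z; rewrite /ordmax /natRV natr_maxn.
have h (n : nat) : n%:R * (1 + ratio n / 2) = moment_comb 1 0 (1 / 2) 0 0 0 n.
  by rewrite /moment_comb; field.
rewrite e (mean_ordmax_nat (f := fun n => n%:R)) -?e; last 2 first.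
- exact: intg_ordmax.
- by under eq_fun do rewrite h; exact: intg_moment_comb.
by under eq_fun do rewrite h; rewrite mean_moment_comb; field.
Qed.

Lemma mean_ordmin_count : mean PP (ordmin (natRV N)) =
  mean P (natRV N) - mean P (fun t => (N t)%:R * ratio (N t)) / 2.
Proof.
have e : ordmin (natRV N) = (fun z => (minn (N z.1) (N z.2))%:R) :> (T * T -> R).
  by apply/funext => z; rewrite /ordmin /natRV natr_minn.
have h (n : nat) : n%:R * (1 - ratio n / 2) = moment_comb 1 0 (- (1 / 2)) 0 0 0 n.
  by rewrite /moment_comb; field.
rewrite e (mean_ordmin_nat (f := fun n => n%:R)) -?e; last 2 first.
- exact: intg_ordmin.
- by under eq_fun do rewrite h; exact: intg_moment_comb.
by under eq_fun do rewrite h; rewrite mean_moment_comb; field.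
Qed.

Lemma mom2_ordmax_count : mom2 PP (ordmax (natRV N)) =
  mom2 P (natRV N) + mean P (fun t => (N t)%:R ^+ 2 * ratio (N t)) / 2.
Proof.
have e : (fun z => ordmax (natRV N) z ^+ 2) =
    (fun z => (maxn (N z.1) (N z.2))%:R ^+ 2) :> (T * T -> R).
  by apply/funext => z; rewrite /ordmax /natRV natr_maxn.
have h (n : nat) : n%:R ^+ 2 * (1 + ratio n / 2) = moment_comb 0 1 0 (1 / 2) 0 0 n.
  by rewrite /moment_comb; field.
rewrite -[LHS]/(mean PP (fun z => ordmax (natRV N) z ^+ 2)).
rewrite e (mean_ordmax_nat (f := fun n => n%:R ^+ 2)) -?e; last 2 first.
- by apply: intg_ordmax_sqr => //; exact: (intg_meas IN1).
- by under eq_fun do rewrite h; exact: intg_moment_comb.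
by under eq_fun do rewrite h; rewrite mean_moment_comb; field.
Qed.

Lemma mom2_ordmin_count : mom2 PP (ordmin (natRV N)) =
  mom2 P (natRV N) - mean P (fun t => (N t)%:R ^+ 2 * ratio (N t)) / 2.
Proof.
have e : (fun z => ordmin (natRV N) z ^+ 2) =
    (fun z => (minn (N z.1) (N z.2))%:R ^+ 2) :> (T * T -> R).
  by apply/funext => z; rewrite /ordmin /natRV natr_minn.
have h (n : nat) : n%:R ^+ 2 * (1 - ratio n / 2) = moment_comb 0 1 0 (- (1 / 2)) 0 0 n.
  by rewrite /moment_comb; field.
rewrite -[LHS]/(mean PP (fun z => ordmin (natRV N) z ^+ 2)).
rewrite e (mean_ordmin_nat (f := fun n => n%:R ^+ 2)) -?e; last 2 first.
- by apply: intg_ordmin_sqr => //; exact: (intg_meas IN1).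
- by under eq_fun do rewrite h; exact: intg_moment_comb.
by under eq_fun do rewrite h; rewrite mean_moment_comb; field.
Qed.

Lemma series_from1 (g : nat -> R) : (forall n, 0 <= g n) -> g 0%N = 0 ->
  intg P (fun t => g (N t)) ->
  (fine (\sum_(1 <= n <oo) (pmfN P N n * g n)%:E) = mean P (fun t => g (N t)))%E.
Proof.
move=> g0 g00 Ig; have := mean_nat_series mN Ig.
rewrite nneseries_recl//; last first.
  by move=> n _; rewrite lee_fin mulr_ge0 ?pmfN_ge0.
by rewrite g00 mulr0 add0e => <-.
Qed.

Lemma series_ratio1 :
  fine (\sum_(1 <= n <oo) (pmfN P N n * n%:R * ratio n ^+ 2)%:E)%E =
  mean P (fun t => (N t)%:R * ratio (N t) ^+ 2).
Proof.
rewrite -(series_from1 (g := fun n => n%:R * ratio n ^+ 2)).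
- by congr fine; apply: eq_eseriesr => n _; rewrite mulrA.
- by move=> n; rewrite mulr_ge0 ?sqr_ge0.
- by rewrite mul0r.
- exact: (@intg_count_ratio 1 2).
Qed.

Lemma series_ratio2 :
  fine (\sum_(1 <= n <oo) (pmfN P N n * n%:R ^+ 2 * ratio n ^+ 2)%:E)%E =
  mean P (fun t => (N t)%:R ^+ 2 * ratio (N t) ^+ 2).
Proof.
rewrite -(series_from1 (g := fun n => n%:R ^+ 2 * ratio n ^+ 2)).
- by congr fine; apply: eq_eseriesr => n _; rewrite mulrA.
- by move=> n; rewrite mulr_ge0 ?sqr_ge0.
- by rewrite expr0n mul0r.
- exact: (@intg_count_ratio 2 2).
Qed.

End CountRatio.

(** * The aggregate claim *)

(** The aggregate claim has a random number of summands, so measurability is checked on each level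
    set of N. *)
Lemma measurable_nat_select {d} {T : measurableType d} {R : realType}
  (N : T -> nat) (Y : nat -> T -> R) :
  measurable_fun setT N -> (forall n, measurable_fun setT (Y n)) ->
  measurable_fun setT (fun t => Y (N t) t).
Proof.
move=> mN mY _ B mB; rewrite setTI.
rewrite (_ : _ @^-1` B = \bigcup_n ([set t | N t == n] `&` (Y n @^-1` B))).
  apply: bigcupT_measurable => n; apply: measurableI.
    by apply: measurable_boolset; exact: (measurable_fun_nat (fun k => k == n)).
  by rewrite -[_ @^-1` _]setTI; exact: mY.
apply/seteqP; split => [t Bt|t [n _ [/= /eqP <-]]] //.
by exists (N t) => //; split => /=.
Qed.

Section Aggregate.
Context {d : measure_display} {T : measurableType d} {R : realType}.
Variables (P : probability T R) (N : T -> nat) (X : nat -> {RV P >-> R}).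
Variable th : forall k : nat, {set 'I_k.+1} -> R.
Hypothesis mN : measurable_fun setT N.
Hypothesis same_cdf :
  forall j x, (1 <= j)%N -> cdfR P (X j) x = cdfR P (X 1%N) x.
Hypothesis X0 : forall j, (1 <= j)%N -> P [set t | X j t <= 0] = 0%E.
Hypothesis IX : intg P (fun t => X 1%N t ^+ 2).
Hypothesis IN1 : intg P (natRV N).
Hypothesis IN2 : intg P (fun t => natRV N t ^+ 2).
Local Notation reached k := (exists n : nat, (k <= n)%N /\ 0 < pmfN P N n).
Hypothesis fgm : forall k, (1 <= k)%N -> reached k ->
  forall (r : R) (x : 'I_k -> R),
    jcdf P N X (fun i : 'I_k => (i : nat).+1) r x =
    fgm_copula (@th k) (fgm_args (cdfN P N r) (fun i => cdfR P (X 1%N) (x i))).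
Hypothesis exch : forall k, (1 <= k)%N -> reached k ->
  forall (s : {perm 'I_k}) (r : R) (x : 'I_k -> R),
    jcdf P N X (fun i : 'I_k => (s i : nat).+1) r x =
    jcdf P N X (fun i : 'I_k => (i : nat).+1) r x.

Let th01 := @th 1%N [set ord0; ord_max]%SET.
Let th12 := @th 2%N [set inord 1; inord 2]%SET.
Let th012 := @th 2%N [set: 'I_3]%SET.
Let X1 : T -> R := X 1%N.
Let X2 : T -> R := X 2%N.
Let m1 := mean P X1.
Let m2 := mom2 P X1.
Let D1 := mean (P \x P)%E (ordmax X1) - mean (P \x P)%E (ordmin X1).
Let D2 := mom2 (P \x P)%E (ordmax X1) - mom2 (P \x P)%E (ordmin X1).
Let rt n : R := ratio P N n.

(* Conditional moments E[X_i | N = n], E[X_i^2 | N = n], E[X_i X_j | N = n]. *)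
Definition cond1 n : R := m1 + th01 / 4 * rt n * D1.
Definition cond2 n : R := m2 + th01 / 4 * rt n * D2.
Definition cond11 n : R := m1 ^+ 2 + th01 / 2 * rt n * (D1 * m1)
  + th12 / 4 * D1 ^+ 2 - th012 / 8 * rt n * D1 ^+ 2.

Lemma mean_level1 i n : (1 <= i <= n)%N -> 0 < pmfN P N n ->
  mean P (fun t => X i t * (N t == n)%:R) = pmfN P N n * cond1 n.
Proof.
move=> iN n0; rewrite (moment1 mN same_cdf X0 IX fgm exch)//.
by rewrite -pmfN_ratio// -/(rt n) /cond1 -/m1 -/th01 -/D1; ring.
Qed.

Lemma mean_level2 i n : (1 <= i <= n)%N -> 0 < pmfN P N n ->
  mean P (fun t => X i t ^+ 2 * (N t == n)%:R) = pmfN P N n * cond2 n.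
Proof.
move=> iN n0; rewrite (moment2 mN same_cdf X0 IX fgm exch)//.
by rewrite -pmfN_ratio// -/(rt n) /cond2 -/m2 -/th01 -/D2; ring.
Qed.

Lemma mean_level11 i j n : (1 <= i <= n)%N -> (1 <= j <= n)%N -> i != j ->
  0 < pmfN P N n ->
  mean P (fun t => X i t * X j t * (N t == n)%:R) = pmfN P N n * cond11 n.
Proof.
move=> iN jN ij n0; rewrite (moment11 mN same_cdf X0 IX fgm exch)//.
by rewrite -pmfN_ratio// -/(rt n) /cond11 -/m1 -/th01 -/th12 -/th012 -/D1; ring.
Qed.

Let S := aggS N (fun j => X j : T -> R).

Let mn n : measurable_fun setT (fun t => N t == n).
Proof. exact: (measurable_fun_nat (fun k => k == n)). Qed.

Let IXj j : (1 <= j)%N -> intg P (X j).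
Proof. exact: (claim_intg same_cdf IX). Qed.

Let IXX i j : (1 <= i)%N -> (1 <= j)%N -> intg P (fun t => X i t * X j t).
Proof. by move=> *; apply: intg_mul => //; exact: (claim_sqr_intg same_cdf IX). Qed.

Lemma measurable_aggS : measurable_fun setT S.
Proof.
by apply: (measurable_nat_select (Y := fun n t => \sum_(1 <= j < n.+1) X j t)) => // n;
   exact: measurable_sum.
Qed.

Let aggS_level n t :
  S t * (N t == n)%:R = \sum_(i < n) X i.+1 t * (N t == n)%:R.
Proof.
rewrite /S /aggS; case: eqP => [->|_]; last first.
  by rewrite mulr0 big1 // => i _; rewrite mulr0.
by rewrite mulr1 big_add1 big_mkord; apply: eq_bigr => i _; rewrite mulr1.
Qed.

Let aggS_sqr_level n t : S t ^+ 2 * (N t == n)%:R =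
  \sum_(i < n) \sum_(j < n) X i.+1 t * X j.+1 t * (N t == n)%:R.
Proof.
transitivity ((S t * (N t == n)%:R) * (S t * (N t == n)%:R)).
  by case: eqP => _; rewrite ?mulr0 ?mulr1.
rewrite aggS_level mulr_suml; apply: eq_bigr => i _.
rewrite mulr_sumr; apply: eq_bigr => j _.
by case: eqP => _; rewrite ?mulr0 ?mulr1.
Qed.

Let I1b n i : intg P (fun t => X i.+1 t * (N t == n)%:R).
Proof. by apply: intg_bool_mul => //; exact: IXj. Qed.

Let I2b n i j : intg P (fun t => X i.+1 t * X j.+1 t * (N t == n)%:R).
Proof. by apply: intg_bool_mul => //; exact: IXX. Qed.

Lemma mean_aggS_level n : 0 < pmfN P N n ->
  mean P (fun t => S t * (N t == n)%:R) = pmfN P N n * (n%:R * cond1 n).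
Proof.
move=> n0; under eq_fun do rewrite aggS_level.
rewrite mean_sum// (eq_bigr (fun=> pmfN P N n * cond1 n)); last first.
  by move=> i _; rewrite mean_level1 /=.
by rewrite sumr_const card_ord -[in LHS]mulr_natl; ring.
Qed.

Lemma mean_aggS_sqr_level n : 0 < pmfN P N n ->
  mean P (fun t => S t ^+ 2 * (N t == n)%:R) =
  pmfN P N n * (n%:R * cond2 n + n%:R * (n%:R - 1) * cond11 n).
Proof.
move=> n0; under eq_fun do rewrite aggS_sqr_level.
rewrite mean_sum; last by move=> i; exact: intg_sum.
(* Each of the [n] rows of the double sum has the same mean: one diagonal square and [n - 1]
   products of distinct claims. *)
rewrite (eq_bigr (fun=> pmfN P N n * (cond2 n + (n%:R - 1) * cond11 n))).
  by rewrite sumr_const card_ord -[in LHS]mulr_natl; ring.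
move=> i _; rewrite mean_sum// (bigD1 i)//=.
rewrite (eq_bigr (fun=> pmfN P N n * cond11 n)); last first.
  move=> j ji; rewrite mean_level11//= ?ltn_ord// eqSS.
  by apply: contra ji => /eqP ij; apply/eqP/val_inj.
rewrite sumr_const cardC1 card_ord -[X in _ + X]mulr_natl -subn1 natrB; last first.
  exact: leq_ltn_trans (ltn_ord i).
have -> : mean P (fun t => X i.+1 t * X i.+1 t * (N t == n)%:R) = pmfN P N n * cond2 n.
  by rewrite -(@mean_level2 i.+1)//=.
by ring.
Qed.

Let cR : R := th01 / 4.

Let aggE n : n%:R * cond1 n = moment_comb P N m1 0 (cR * D1) 0 0 0 n.
Proof. by rewrite /moment_comb /cond1 -/(rt n) /cR; field. Qed.

Let aggE2 n : n%:R * cond2 n + n%:R * (n%:R - 1) * cond11 n =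
  moment_comb P N (m2 - m1 ^+ 2 - th12 / 4 * D1 ^+ 2)
   (m1 ^+ 2 + th12 / 4 * D1 ^+ 2)
   (cR * D2 - (th01 / 2 * (D1 * m1) - th012 / 8 * D1 ^+ 2))
   (th01 / 2 * (D1 * m1) - th012 / 8 * D1 ^+ 2) 0 0 n.
Proof. by rewrite /moment_comb /cond2 /cond11 -/(rt n) /cR; field. Qed.

Lemma intg_aggS_sqr : intg P (fun t => S t ^+ 2).
Proof.
apply: (ge0_intg_tower mN
  (f := fun n => n%:R * cond2 n + n%:R * (n%:R - 1) * cond11 n)) => //.
- by apply: measurable_funX; exact: measurable_aggS.
- by move=> t; exact: sqr_ge0.
- move=> n; under eq_fun do rewrite aggS_sqr_level.
  by apply: intg_sum => i; exact: intg_sum.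
- by under eq_fun do rewrite aggE2; exact: intg_moment_comb.
- exact: mean_aggS_sqr_level.
Qed.

Let A1 := mean P (natRV N).
Let A2 := mom2 P (natRV N).
(** By the density 1 +- R/2, [B1] and [B2] are the differences of the first and second moments of
    the extremes of N; [C1] and [C2] are the two series in R_n^2. *)
Let B1 := mean P (fun t => (N t)%:R * ratio P N (N t)).
Let B2 := mean P (fun t => (N t)%:R ^+ 2 * ratio P N (N t)).
Let C1 := mean P (fun t => (N t)%:R * ratio P N (N t) ^+ 2).
Let C2 := mean P (fun t => (N t)%:R ^+ 2 * ratio P N (N t) ^+ 2).

Lemma mean_aggS : mean P S = m1 * A1 + cR * D1 * B1.
Proof.
rewrite (mean_tower mN (f := fun n => n%:R * cond1 n)).
- by under eq_fun do rewrite aggE; rewrite mean_moment_comb// !mul0r !addr0.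
- by apply: intg_sqrW; [exact: measurable_aggS|exact: intg_aggS_sqr].
- by under eq_fun do rewrite aggE; exact: intg_moment_comb.
- exact: mean_aggS_level.
Qed.

Lemma mom2_aggS : mom2 P S =
  (m2 - m1 ^+ 2 - th12 / 4 * D1 ^+ 2) * A1 + (m1 ^+ 2 + th12 / 4 * D1 ^+ 2) * A2
  + (cR * D2 - (th01 / 2 * (D1 * m1) - th012 / 8 * D1 ^+ 2)) * B1
  + (th01 / 2 * (D1 * m1) - th012 / 8 * D1 ^+ 2) * B2.
Proof.
rewrite -[LHS]/(mean P (fun t => S t ^+ 2)).
rewrite (mean_tower mN
  (f := fun n => n%:R * cond2 n + n%:R * (n%:R - 1) * cond11 n)).
- by under eq_fun do rewrite aggE2; rewrite mean_moment_comb// !mul0r !addr0.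
- exact: intg_aggS_sqr.
- by under eq_fun do rewrite aggE2; exact: intg_moment_comb.
- exact: mean_aggS_sqr_level.
Qed.

Lemma variance_aggS : ('V_P[S] = (mom2 P S - mean P S ^+ 2)%:E)%E.
Proof. exact: (variance_mean measurable_aggS intg_aggS_sqr). Qed.

(** [condE P N Y t] unfolds to [cE Y (N t)] once the mass function is in boolean form: all
    conditional quantities are functions of N. *)
Let cE (Y : T -> R) n := mean P (fun w => Y w * (N w == n)%:R) / pmfN P N n.

Let cE1 i n : (1 <= i <= n)%N -> 0 < pmfN P N n -> cE (X i) n = cond1 n.
Proof. by move=> iN n0; rewrite /cE mean_level1// mulrC mulKf// gt_eqF. Qed.

Let cE2 n : (1 <= n)%N -> 0 < pmfN P N n ->
  cE (fun w => X1 w ^+ 2) n = cond2 n.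
Proof. by move=> iN n0; rewrite /cE mean_level2// mulrC mulKf// gt_eqF. Qed.

Let cE11 n : (2 <= n)%N -> 0 < pmfN P N n ->
  cE (fun w => X1 w * X2 w) n = cond11 n.
Proof.
move=> nge n0; rewrite /cE (@mean_level11 1%N 2%N)//.
  by rewrite mulrC mulKf// gt_eqF.
by rewrite /=; lia.
Qed.

Lemma expectation_N_condVar :
  ('E_P[(fun t => (natRV N t * condVar P N X1 t)%R)] =
  (A1 * (m2 - m1 ^+ 2) + cR * B1 * (D2 - 2 * m1 * D1) - cR ^+ 2 * D1 ^+ 2 * C1)%:E)%E.
Proof.
pose f n := moment_comb P N (m2 - m1 ^+ 2) 0 (cR * (D2 - 2 * m1 * D1)) 0
  (- (cR ^+ 2 * D1 ^+ 2)) 0 n.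
have e n : 0 < pmfN P N n ->
    n%:R * (cE (fun w => X1 w ^+ 2) n - cE X1 n ^+ 2) = f n.
  (* At [n = 0] the copula says nothing about X_1 given N = n, but the factor [n] vanishes. *)
  rewrite /f /moment_comb; case: n => [|n] n0; first by ring.
  rewrite cE2// cE1// /cond2 /cond1 -/(rt _) /cR; by field.
rewrite (expectation_nat_eq mN e) expectation_mean; last exact: intg_moment_comb.
by congr EFin; rewrite mean_moment_comb// -/A1 -/A2 -/B1 -/B2 -/C1 -/C2; ring.
Qed.

(** The factor n (n - 1) removes the levels 0 and 1, where the pair (X_1, X_2) is not controlled. If
    N is at most 1 almost surely, both sides are therefore 0. *)
Lemma expectation_N_condCov :
  ('E_P[(fun t => (natRV N t * (natRV N t - 1) * condCov P N X1 X2 t)%R)] =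
  (th12 / 4 * D1 ^+ 2 * (A2 - A1) - th012 / 8 * D1 ^+ 2 * (B2 - B1)
   - cR ^+ 2 * D1 ^+ 2 * C2 + cR ^+ 2 * D1 ^+ 2 * C1)%:E)%E.
Proof.
pose f n := moment_comb P N (- (th12 / 4 * D1 ^+ 2)) (th12 / 4 * D1 ^+ 2)
  (th012 / 8 * D1 ^+ 2) (- (th012 / 8 * D1 ^+ 2))
  (cR ^+ 2 * D1 ^+ 2) (- (cR ^+ 2 * D1 ^+ 2)) n.
have e n : 0 < pmfN P N n ->
    n%:R * (n%:R - 1) * (cE (fun w => X1 w * X2 w) n - cE X1 n * cE X2 n) = f n.
  rewrite /f /moment_comb; case: n => [|[|n]] n0; [by ring|by ring|].
  rewrite cE11// cE1// cE1// /cond11 /cond1 -/(rt _) /cR; by field.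
rewrite (expectation_nat_eq mN e) expectation_mean; last exact: intg_moment_comb.
by congr EFin; rewrite mean_moment_comb// -/A1 -/A2 -/B1 -/B2 -/C1 -/C2; ring.
Qed.

Lemma variance_N_condE :
  ('V_P[(fun t => (natRV N t * condE P N X1 t)%R)] =
  (m1 ^+ 2 * A2 + 2 * m1 * cR * D1 * B2 + cR ^+ 2 * D1 ^+ 2 * C2
   - (m1 * A1 + cR * D1 * B1) ^+ 2)%:E)%E.
Proof.
have e n : 0 < pmfN P N n ->
    n%:R * cE X1 n = moment_comb P N m1 0 (cR * D1) 0 0 0 n.
  case: n => [|n] n0; first by rewrite /moment_comb; ring.
  by rewrite cE1// aggE.
rewrite (variance_nat_eq mN e).
(* The conditional mean is affine in R_n, so its square times n^2 stays in the normal form. *)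
have e2 n : moment_comb P N m1 0 (cR * D1) 0 0 0 n ^+ 2 =
    moment_comb P N 0 (m1 ^+ 2) 0 (2 * m1 * cR * D1) 0 (cR ^+ 2 * D1 ^+ 2) n.
  by rewrite /moment_comb; ring.
rewrite variance_mean; last 2 first.
- exact: (measurable_fun_nat (fun n => moment_comb P N m1 0 (cR * D1) 0 0 0 n)).
- by under eq_fun do rewrite e2; exact: intg_moment_comb.
congr EFin; under eq_fun do rewrite e2.
by rewrite !mean_moment_comb// -/A1 -/A2 -/B1 -/B2 -/C1 -/C2; ring.
Qed.

End Aggregate.

Theorem mainTheorem10 (d : measure_display) (T : measurableType d) (R : realType)
  (P : probability T R) (N : T -> nat) (X : nat -> {RV P >-> R})
  (th : forall k : nat, {set 'I_k.+1} -> R) :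
  (* N is a random variable with values in N_0 *)
  (forall n : nat, measurable [set t | N t = n]) ->
  (* X_1, X_2, ... identically distributed (common cdf F_X = cdf of X_1) *)
  (forall (j : nat) (x : R), (1 <= j)%N -> cdfR P (X j) x = cdfR P (X 1%N) x) ->
  (* strictly positive *)
  (forall j : nat, (1 <= j)%N -> P [set t | X j t <= 0] = 0%E) ->
  (* (N, X) in aleph^{FGM}: for every k in N_1 with k <= sup A_N *)
  (forall k : nat, (1 <= k)%N -> (exists n : nat, (k <= n)%N /\ 0 < pmfN P N n) ->
     fgm_admissible (th k) /\
     (forall (r : R) (x : 'I_k -> R),
        jcdf P N X (fun i : 'I_k => (i : nat).+1) r x =
        fgm_copula (th k) (fgm_args (cdfN P N r) (fun i => cdfR P (X 1%N) (x i))))) ->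
  (* exchangeability: (N, X_1..X_k) =d (N, X_pi(1)..X_pi(k)) *)
  (forall k : nat, (1 <= k)%N -> (exists n : nat, (k <= n)%N /\ 0 < pmfN P N n) ->
     forall (s : {perm 'I_k}) (r : R) (x : 'I_k -> R),
       jcdf P N X (fun i : 'I_k => (s i : nat).+1) r x =
       jcdf P N X (fun i : 'I_k => (i : nat).+1) r x) ->
  (* E[N^k] < oo, E[X^k] < oo, k = 1, 2 *)
  P.-integrable setT (EFin \o natRV N) ->
  P.-integrable setT (EFin \o (fun t => natRV N t ^+ 2)) ->
  P.-integrable setT (EFin \o X 1%N) ->
  P.-integrable setT (EFin \o (fun t => X 1%N t ^+ 2)) ->
  let th01 := th 1%N [set ord0; ord_max]%SET in
  let th12 := th 2%N [set inord 1; inord 2]%SET in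
  let th012 := th 2%N [set: 'I_3]%SET in
  let Nr := natRV N in
  let X1 : T -> R := X 1%N in
  let X2 : T -> R := X 2%N in
  let S := aggS N (fun j => X j : T -> R) in
  let muN := mean P Nr in
  let muN2 := mom2 P Nr in
  let varN := var P Nr in
  let muNmin := mean (P \x P)%E (ordmin Nr) in
  let muNmax := mean (P \x P)%E (ordmax Nr) in
  let muNmin2 := mom2 (P \x P)%E (ordmin Nr) in
  let muNmax2 := mom2 (P \x P)%E (ordmax Nr) in
  let varNmin := var (P \x P)%E (ordmin Nr) in
  let varNmax := var (P \x P)%E (ordmax Nr) in
  let muX := mean P X1 in
  let varX := var P X1 in
  let muXmin := mean (P \x P)%E (ordmin X1) in
  let muXmax := mean (P \x P)%E (ordmax X1) in
  let varXmin := var (P \x P)%E (ordmin X1) in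
  let varXmax := var (P \x P)%E (ordmax X1) in
  let Rn := fun n : nat => (pmfNmax P N n - pmfNmin P N n) / pmfN P N n in
  let D := muXmax - muXmin in
  let sum1 := fine (\sum_(1 <= n <oo) (pmfN P N n * n%:R * Rn n ^+ 2)%:E)%E in
  let sum2 := fine (\sum_(1 <= n <oo) (pmfN P N n * n%:R ^+ 2 * Rn n ^+ 2)%:E)%E in
  let ENVar := 'E_P[fun t => (Nr t * condVar P N X1 t)%R]%E in
  let ENNCov := 'E_P[fun t => (Nr t * (Nr t - 1) * condCov P N X1 X2 t)%R]%E in
  let VarNE := 'V_P[fun t => (Nr t * condE P N X1 t)%R]%E in
  [/\ 'V_P[S]%E = (ENVar + ENNCov + VarNE)%E,
      ENVar = (muN * varX
               + th01 / 4%:R * (muNmax - muNmin) * (varXmax - varXmin)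
               - th01 ^+ 2 / 16%:R * D ^+ 2 * sum1)%:E,
      ENNCov = (th12 / 4%:R * (muN2 - muN) * D ^+ 2
                - th012 / 8%:R * (muNmax2 - muNmax - muNmin2 + muNmin) * D ^+ 2
                - th01 ^+ 2 / 16%:R * D ^+ 2 * sum2
                + th01 ^+ 2 / 16%:R * D ^+ 2 * sum1)%:E,
      VarNE = (varN * muX ^+ 2
               + th01 / 4%:R * (varNmax - varNmin) * (muXmax ^+ 2 - muXmin ^+ 2)
               + th01 / 8%:R * (muNmax ^+ 2 - muNmin ^+ 2) * (muXmax ^+ 2 - muXmin ^+ 2)
               + th01 ^+ 2 / 16%:R * D ^+ 2 * sum2
               - th01 ^+ 2 / 16%:R * (muNmax - muNmin) ^+ 2 * D ^+ 2)%:E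
    & 'V_P[S]%E =
      (muN * varX + varN * muX ^+ 2
       + (th01 / 4%:R * ((muNmax - muNmin) * (varXmax - varXmin)
                         + (varNmax - varNmin) * (muXmax ^+ 2 - muXmin ^+ 2)
                         + 2%:R^-1 * (muNmax ^+ 2 - muNmin ^+ 2) * (muXmax ^+ 2 - muXmin ^+ 2))
          - th01 ^+ 2 / 16%:R * (muNmax - muNmin) ^+ 2 * D ^+ 2
          + th12 / 4%:R * (muN2 - muN) * D ^+ 2
          - th012 / 8%:R * ((muNmax2 - muNmax) - (muNmin2 - muNmin)) * D ^+ 2))%:E].
Proof.
move=> mN0 same_cdf X0 fgmP exch IN1 IN2 IX1 IX2.
have mN := measurable_nat mN0.
have fgm k (k1 : (1 <= k)%N) kr := (fgmP k k1 kr).2.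
have mX : measurable_fun setT (X 1%N : T -> R) by [].
move=> th01 th12 th012 Nr X1 X2 S muN muN2 varN muNmin muNmax muNmin2 muNmax2
  varNmin varNmax muX varX muXmin muXmax varXmin varXmax Rn D sum1 sum2
  ENVar ENNCov VarNE.
have mNr : measurable_fun setT Nr by exact: intg_meas IN1.
have E1 := expectation_N_condVar mN same_cdf X0 IX2 IN1 IN2 fgm exch.
have E2 := expectation_N_condCov mN same_cdf X0 IX2 IN1 IN2 fgm exch.
have E3 := variance_N_condE mN same_cdf X0 IX2 IN1 IN2 fgm exch.
have ES := variance_aggS mN same_cdf X0 IX2 IN1 IN2 fgm exch.
rewrite (mom2_aggS mN same_cdf X0 IX2 IN1 IN2 fgm exch) in ES.
rewrite (mean_aggS mN same_cdf X0 IX2 IN1 IN2 fgm exch) in ES.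
have eNmax : muNmax = _ := mean_ordmax_count mN IN1 IN2.
have eNmin : muNmin = _ := mean_ordmin_count mN IN1 IN2.
have eNmax2 : muNmax2 = _ := mom2_ordmax_count mN IN1 IN2.
have eNmin2 : muNmin2 = _ := mom2_ordmin_count mN IN1 IN2.
have eX := mean_ordmaxDmin mX (claim_ae_ge0 X0 (leqnn 1)) IX2.
have vN : varN = muN2 - muN ^+ 2 by exact: var_mean.
have vNmax : varNmax = muNmax2 - muNmax ^+ 2.
  by apply: var_mean; [exact: measurable_ordmax|exact: intg_ordmax_sqr].
have vNmin : varNmin = muNmin2 - muNmin ^+ 2.
  by apply: var_mean; [exact: measurable_ordmin|exact: intg_ordmin_sqr].
have vX : varX = mom2 P X1 - muX ^+ 2 by exact: var_mean.
have vXmax : varXmax = mom2 (P \x P)%E (ordmax X1) - muXmax ^+ 2.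
  by apply: var_mean; [exact: measurable_ordmax|exact: intg_ordmax_sqr].
have vXmin : varXmin = mom2 (P \x P)%E (ordmin X1) - muXmin ^+ 2.
  by apply: var_mean; [exact: measurable_ordmin|exact: intg_ordmin_sqr].
have s1 : sum1 = _ := series_ratio1 mN IN1 IN2.
have s2 : sum2 = _ := series_ratio2 mN IN1 IN2.
(* Eliminating [muXmin] makes 2 [muX] D equal to [muXmax ^+ 2 - muXmin ^+ 2] as a polynomial
   identity. *)
have {}eX : muXmin = 2 * muX - muXmax by rewrite -eX addrAC subrr add0r.
have -> : ENVar = _ := E1.
have -> : ENNCov = _ := E2.
have -> : VarNE = _ := E3.
have -> : ('V_P[S])%E = _ := ES.
rewrite -!EFinD vN vNmax vNmin vX vXmax vXmin eNmax eNmin eNmax2 eNmin2 s1 s2.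
rewrite -/X1 -/muX -/muXmin -/muXmax -/D -/th01 -/th12 -/th012.
rewrite -/Nr -/muN -/muN2 /D eX.
(* Everything is now a rational expression in the same moments. In the sum of the three components
   the R_n^2 series cancel: the first from the variance and covariance terms, the second from the
   covariance term and the variance of N E[X_1 | N]. *)
by split; congr EFin; field.
Qed.
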